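(* For every $n\in\mathbb{Z}_{>0}$, let $\boldsymbol{\sigma}^n$ be a random permutation of size $n$. Then: (a) the sequence $(\boldsymbol{\sigma}^n)_{n\in\mathbb{Z}_{>0}}$ converges in the annealed Benjamini--Schramm sense if and only if there exist non-negative real numbers $(\Delta_\pi)_{\pi\in\mathcal{S}}$ such that $\mathbb{E}[\widetilde{\mathrm{c\text{-}occ}}(\pi,\boldsymbol{\sigma}^n)]\to\Delta_\pi$ as $n\to\infty$ for all patterns $\pi\in\mathcal{S}$; (b) the sequence $(\boldsymbol{\sigma}^n)_{n\in\mathbb{Z}_{>0}}$ converges in the quenched Benjamini--Schramm sense if and only if there exist non-negative real random variables $(\boldsymbol{\Lambda}_\pi)_{\pi\in\mathcal{S}}$ such that $\big(\widetilde{\mathrm{c\text{-}occ}}(\pi,\boldsymbol{\sigma}^n)\big)_{\pi\in\mathcal{S}}\to(\boldsymbol{\Lambda}_\pi)_{\pi\in\mathcal{S}}$ in distribution with respect to the product topology. Moreover, quenched Benjamini--Schramm convergence implies annealed Benjamini--Schramm convergence.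
   Context: All intervals $[a,b]$ are integer intervals. $\mathcal{S}^n$ is the set of permutations $\sigma=\sigma_1\cdots\sigma_n$ of $[n]=\{1,\dots,n\}$, $|\sigma|=n$ is the size, and $\mathcal{S}=\bigcup_{n\ge1}\mathcal{S}^n$. For $I\subseteq[n]$, $\mathrm{pat}_I(\sigma)$ is the permutation of size $|I|$ in the same relative order as $(\sigma_i)_{i\in I}$. For $\pi\in\mathcal{S}$, $\mathrm{c\text{-}occ}(\pi,\sigma)$ is the number of intervals $I\subseteq[n]$ with $|I|=|\pi|$ and $\mathrm{pat}_I(\sigma)=\pi$, and $\widetilde{\mathrm{c\text{-}occ}}(\pi,\sigma)=\mathrm{c\text{-}occ}(\pi,\sigma)/n$ where $n=|\sigma|$. Rooted permutations. A finite rooted permutation is a pair $(\sigma,i)$ with $\sigma\in\mathcal{S}^n$, $i\in[n]$. It is identified with the pair $(A_{\sigma,i},\preccurlyeq_{\sigma,i})$, where $A_{\sigma,i}=[-i+1,|\sigma|-i]$ and $\preccurlyeq_{\sigma,i}$ is the total order on it given by $\ell\preccurlyeq_{\sigma,i}j\iff\sigma_{\ell+i}\le\sigma_{j+i}$; this is a bijection between finite rooted permutations and total orders on finite integer intervals containing $0$. An infinite rooted permutation is a pair $(A,\preccurlyeq)$ with $A$ an infinite integer interval containing $0$ and $\preccurlyeq$ a total order on $A$. $\tilde{\mathcal{S}}_\bullet$ is the set of all finite and infinite rooted permutations. For $h\in\mathbb{Z}_{>0}$, $r_h(A,\preccurlyeq)=(A\cap[-h,h],\preccurlyeq)$. The local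 distance on $\tilde{\mathcal{S}}_\bullet$ is $d(x,y)=2^{-\sup\{h\in\mathbb{Z}_{>0}:\,r_h(x)=r_h(y)\}}$, with $\sup\emptyset=0$, $\sup\mathbb{Z}_{>0}=+\infty$, $2^{-\infty}=0$. Annealed convergence: $(\boldsymbol{\sigma}^n)$ converges in the annealed Benjamini--Schramm sense if there is a random variable $\boldsymbol{\sigma}^\infty$ with values in $\tilde{\mathcal{S}}_\bullet$ such that, with $\boldsymbol{i}_n$ a uniform index of $\boldsymbol{\sigma}^n$ conditionally on $\boldsymbol{\sigma}^n$, the random rooted permutations $(\boldsymbol{\sigma}^n,\boldsymbol{i}_n)$ converge in distribution to $\boldsymbol{\sigma}^\infty$ with respect to $d$. Quenched convergence: for a permutation $\sigma$, let $\mu_\sigma$ be the law of $(\sigma,\boldsymbol{i})$ with $\boldsymbol{i}$ uniform in $[|\sigma|]$, a probability measure on $\tilde{\mathcal{S}}_\bullet$. $(\boldsymbol{\sigma}^n)$ converges in the quenched Benjamini--Schramm sense if there is a random probability measure $\boldsymbol{\mu}^\infty$ on $\tilde{\mathcal{S}}_\bullet$ such that the random measures $\mu_{\boldsymbol{\sigma}^n}$ converge in distribution to $\boldsymbol{\mu}^\infty$ with respect to the weak topology on probability measures on $(\tilde{\mathcal{S}}_\bullet,d)$. *)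

(* Defs.v *)
From HB Require Import structures.
From mathcomp Require Import all_boot all_order all_algebra all_fingroup.
From mathcomp Require Import all_classical all_reals all_analysis.
From mathcomp Require Import zify.

Set Implicit Arguments.
Unset Strict Implicit.
Unset Printing Implicit Defensive.

Import Order.TTheory GRing.Theory Num.Theory.
Import numFieldNormedType.Exports.

Local Open Scope ring_scope.

(* Positions and values are 0-based: 'S_n permutes {0, ..., n-1} instead of   *)
(* {1, ..., n}. An element existT _ k p of pattern has size k.+1, so that     *)
(* pattern is the set of all permutations of positive size.                   *)
Definition pattern : Type := {k : nat & 'S_k.+1}.

Section Patterns.
Variable n : nat.
Implicit Types (I : {set 'I_n}) (s : 'S_n).

(* enum_val lists I in increasing order, so (s (enum_val a))_a is the         *)
(* sequence (s i)_(i in I).                                                   *)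
Definition pat_rank I s (a : 'I_#|I|) : nat :=
  #|[set i in I | (s i < s (enum_val a))%N]|.

Lemma pat_rank_lt I s (a b : 'I_#|I|) :
  (pat_rank s a < pat_rank s b)%N = (s (enum_val a) < s (enum_val b))%N.
Proof.
have H (c d : 'I_#|I|) : (s (enum_val c) < s (enum_val d))%N ->
    (pat_rank s c < pat_rank s d)%N.
  move=> cd; apply: proper_card; apply/properP; split.
    by apply/fintype.subsetP => i; rewrite !inE => /andP[-> /ltn_trans]; apply.
  by exists (enum_val c); rewrite !inE ?ltnn ?andbF// enum_valP cd.
apply/idP/idP; last exact: H.
apply: contraTT; rewrite -!leqNgt leq_eqVlt => /orP[/eqP/val_inj e|/H/ltnW//].
by rewrite /pat_rank e.
Qed.

Lemma pat_rank_bound I s (a : 'I_#|I|) : (pat_rank s a < #|I|)%N.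
Proof.
apply: proper_card; apply/properP; split.
  by apply/fintype.subsetP => i; rewrite !inE => /andP[].
by exists (enum_val a); rewrite ?inE ?ltnn ?andbF// enum_valP.
Qed.

Lemma pat_inj I s : injective (fun a : 'I_#|I| => Ordinal (pat_rank_bound s a)).
Proof.
move=> a b [e]; apply/enum_val_inj/(@perm_inj _ s)/ord_inj.
have := pat_rank_lt s a b; have := pat_rank_lt s b a; rewrite e ltnn.
by case: ltngtP.
Qed.

Definition pat I s : 'S_#|I| := perm (@pat_inj I s).

Lemma pat_lt I s (a b : 'I_#|I|) :
  (pat I s a < pat I s b)%N = (s (enum_val a) < s (enum_val b))%N.
Proof. by rewrite !permE /= pat_rank_lt. Qed.

Definition is_interval I : bool :=
  [exists a : 'I_n, exists b : 'I_n, I == [set i : 'I_n | a <= i <= b]%N].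

(* Equality of permutations of possibly different sizes is tested in          *)
(* {k & 'S_k}; it entails #|I| = k.+1.                                        *)
Definition c_occ (p : pattern) s : nat :=
  #|[set I : {set 'I_n} | is_interval I &&
      (existT (fun k => 'S_k) #|I| (pat I s) ==
       existT (fun k => 'S_k) (tag p).+1 (tagged p))]|.

Definition prop_c_occ (R : realType) (p : pattern) s : R :=
  (c_occ p s)%:R / n%:R.

End Patterns.

Local Open Scope classical_set_scope.

(* A finite or infinite rooted permutation: an integer interval A containing  *)
(* 0 with a total order on A. The order is a relation on int supported on A,  *)
(* so that Leibniz equality is equality of pairs (A, order).                  *)
Record rooted_perm := RootedPerm {
  rp_dom : set int;
  rp_le : int -> int -> Prop;
  rp_dom0 : rp_dom 0;
  rp_dom_interval : forall a b c, rp_dom a -> rp_dom c -> a <= b <= c ->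
    rp_dom b;
  rp_le_dom : forall a b, rp_le a b -> rp_dom a /\ rp_dom b;
  rp_le_refl : forall a, rp_dom a -> rp_le a a;
  rp_le_anti : forall a b, rp_le a b -> rp_le b a -> a = b;
  rp_le_trans : forall a b c, rp_le a b -> rp_le b c -> rp_le a c;
  rp_le_total : forall a b, rp_dom a -> rp_dom b -> rp_le a b \/ rp_le b a }.

Lemma rooted_perm_eq (x y : rooted_perm) :
  rp_dom x = rp_dom y -> rp_le x = rp_le y -> x = y.
Proof.
case: x y => [A le ? ? ? ? ? ? ?] [B le' ? ? ? ? ? ? ?] /= AB lele'.
by subst; f_equal; exact: Prop_irrelevance.
Qed.

Section Restriction.
Variables (h : nat) (x : rooted_perm).

Definition restr_dom : set int := rp_dom x `&` [set a | - h%:Z <= a <= h%:Z].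
Definition restr_le (a b : int) : Prop :=
  [/\ rp_le x a b, restr_dom a & restr_dom b].

Program Definition restr : rooted_perm :=
  @RootedPerm restr_dom restr_le _ _ _ _ _ _ _.
Next Obligation. by split; [exact: rp_dom0 | rewrite /=; lia]. Qed.
Next Obligation.
move=> a b c [xa /= ha] [xc /= hc] /= abc.
by split=> /=; [exact: rp_dom_interval xa xc abc | lia].
Qed.
Next Obligation. by move=> a b []. Qed.
Next Obligation. by move=> a ra; split=> //; apply: rp_le_refl; case: ra. Qed.
Next Obligation. by move=> a b [ab _ _] [ba _ _]; exact: rp_le_anti ab ba. Qed.
Next Obligation.
by move=> a b c [ab ra _] [bc _ rc]; split=> //; exact: rp_le_trans ab bc.
Qed.
Next Obligation.
move=> a b ra rb; have [xa _] := ra; have [xb _] := rb.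
by have [ab|ba] := rp_le_total xa xb; [left | right].
Qed.

End Restriction.

Section FiniteRootedPermutation.
Variables (n : nat) (s : 'S_n) (i : 'I_n).

(* With 0-based i, the domain [-i+1, n-i] of the 1-based convention reads     *)
(* [-i, n-1-i].                                                               *)
Definition root_dom : set int := [set l : int | - i%:Z <= l <= n%:Z - 1 - i%:Z].
Definition root_le (l j : int) : Prop := exists a b : 'I_n,
  [/\ a%:Z = l + i%:Z, b%:Z = j + i%:Z & (s a <= s b)%N].

Lemma root_domP (l : int) : root_dom l -> exists a : 'I_n, a%:Z = l + i%:Z.
Proof.
rewrite /root_dom /= => hl; have hn : (absz (l + i%:Z)%R < n)%N by lia.
by exists (Ordinal hn) => /=; lia.
Qed.

Lemma root_ord (a : 'I_n) (l : int) : a%:Z = l + i%:Z -> root_dom l.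
Proof. by rewrite /root_dom /=; have := ltn_ord a; lia. Qed.

Program Definition rooted : rooted_perm :=
  @RootedPerm root_dom root_le _ _ _ _ _ _ _.
Next Obligation. by have := ltn_ord i; rewrite /root_dom /=; lia. Qed.
Next Obligation. by move=> a b c; rewrite /root_dom /=; lia. Qed.
Next Obligation. by move=> a b [c [d [/root_ord ? /root_ord ?]]]. Qed.
Next Obligation. by move=> a /root_domP[c ca]; exists c, c. Qed.
Next Obligation.
move=> a b [c [d [ca db cd]]] [d' [c' [db' ca' dc]]].
have e1 : d' = d by apply/val_inj/eqP; rewrite -eqz_nat db db'.
have e2 : c' = c by apply/val_inj/eqP; rewrite -eqz_nat ca ca'.
subst; have : c = d.
  by apply/(@perm_inj _ s)/val_inj/eqP; rewrite eqn_leq cd dc.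
by move=> e; subst; apply: (addIr i%:Z); rewrite -ca -db.
Qed.
Next Obligation.
move=> a b c [u [v [ua vb uv]]] [v' [w [vb' wc vw]]].
have e : v' = v by apply/val_inj/eqP; rewrite -eqz_nat vb vb'.
by subst; exists u, w; split=> //; exact: leq_trans vw.
Qed.
Next Obligation.
move=> a b /root_domP[c ca] /root_domP[d db].
by case/orP: (leq_total (s c) (s d)) => cd; [left; exists c, d | right; exists d, c].
Qed.

End FiniteRootedPermutation.

Section LocalDistance.
Variable R : realType.
Implicit Types x y z : rooted_perm.

Definition agree x y : set nat :=
  [set h | (0 < h)%N /\ restr h x = restr h y].

(* The element 0 is added to implement the convention sup set0 = 0; it does   *)
(* not change the supremum of a nonempty set of positive integers.            *)
Definition agree_sup x y : \bar R :=
  ereal_sup (0%E |` [set h%:R%:E | h in agree x y]).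

Definition exp2N (e : \bar R) : R :=
  match e with
  | r%:E => 2 `^ (- r)
  | +oo%E => 0
  | -oo%E => 0 (* not reached: agree_sup is nonnegative *)
  end.

Definition local_dist x y : R := exp2N (agree_sup x y).

Lemma agree_sup_ge0 x y : (0 <= agree_sup x y)%E.
Proof. by apply: ereal_sup_ubound; left. Qed.

Lemma agree_sup_ge x y h : agree x y h -> (h%:R%:E <= agree_sup x y)%E.
Proof. by move=> hh; apply: ereal_sup_ubound; right; exists h. Qed.

Lemma restr_restr h k x : (h <= k)%N -> restr h (restr k x) = restr h x.
Proof.
move=> hk; have E : restr_dom h (restr k x) = restr_dom h x.
  apply/seteqP; split=> a /=; rewrite /restr_dom /= => [][]; first by case.
  by move=> ? ?; do !split=> //=; lia.
apply: rooted_perm_eq => //=; apply/funext => a; apply/funext => b /=.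
rewrite /restr_le E; apply/propext; split=> [[[]]//|[ab ra rb]].
split=> //; split=> //.
  by move: ra; rewrite -E => -[].
by move: rb; rewrite -E => -[].
Qed.

Lemma agree_le x y h k : (0 < h <= k)%N -> agree x y k -> agree x y h.
Proof.
move=> /andP[h0 hk] [k0 e]; split=> //.
by rewrite -(restr_restr x hk) -(restr_restr y hk) e.
Qed.

Lemma exp2N_ge0 e : 0 <= exp2N e.
Proof. by case: e => //= r; exact: powR_ge0. Qed.

Lemma exp2N_anti e f : (0 <= e)%E -> (e <= f)%E -> exp2N f <= exp2N e.
Proof.
case: e f => [r||] [s||] //= _; rewrite ?lee_fin => rs; rewrite ?powR_ge0//.
by apply: ler_powR; rewrite ?ler1n ?lerN2.
Qed.

Lemma agree_sup_gt x y (e : \bar R) : (0 <= e)%E -> (e < agree_sup x y)%E ->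
  exists2 h, agree x y h & (e < h%:R%:E)%E.
Proof.
move=> e0 /ereal_sup_gt[_ [->|[h hh <-]] eh]; last by exists h.
by move: eh; rewrite ltNge e0.
Qed.

Lemma agree_sup_ultra y x z :
  (mine (agree_sup x y) (agree_sup y z) <= agree_sup x z)%E.
Proof.
rewrite leNgt; apply/negP; rewrite lt_min => /andP[].
have e0 := agree_sup_ge0 x z.
move=> /(agree_sup_gt e0)[h xyh eh] /(agree_sup_gt e0)[k yzk ek].
have m0 : (0 < minn h k)%N by rewrite leq_min xyh.1 yzk.1.
have [_ xym] : agree x y (minn h k).
  by apply: agree_le xyh; rewrite m0 geq_minl.
have [_ yzm] : agree y z (minn h k).
  by apply: agree_le yzk; rewrite m0 geq_minr.
have /agree_sup_ge : agree x z (minn h k) by split=> //; rewrite xym.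
by rewrite leNgt; case: leqP => _; rewrite ?eh ?ek.
Qed.

Lemma agree_sup_pinfty x y : agree_sup x y = +oo%E <-> x = y.
Proof.
split=> [e|->].
  have A h : restr h x = restr h y.
    have [k xyk hk] : exists2 k, agree x y k & (h.+1%:R%:E < k%:R%:E :> \bar R)%E.
      by apply: agree_sup_gt; rewrite ?lee_fin// e ltry.
    have hk' : (h <= k)%N.
      by move: hk; rewrite lte_fin ltr_nat => /ltnW/ltnW.
    by rewrite -(restr_restr x hk') -(restr_restr y hk') xyk.2.
  have D u v : (forall h, restr h u = restr h v) -> rp_dom u `<=` rp_dom v.
    move=> uv a ua; have : rp_dom (restr (absz a) u) a.
      by split=> //=; lia.
    by rewrite uv => -[].
  have L u v : (forall h, restr h u = restr h v) ->
      forall a b, rp_le u a b -> rp_le v a b.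
    move=> uv a b ab; have [ua ub] := rp_le_dom ab.
    have : rp_le (restr (absz a + absz b)%N u) a b.
      by split=> //; split=> //=; lia.
    by rewrite uv => -[].
  apply: rooted_perm_eq; first by apply/seteqP; split; apply: D.
  apply/funext => a; apply/funext => b; apply/propext.
  by split; apply: L.
apply/eqP; rewrite eq_le leey /= leNgt; apply/negP => lt.
have A h : (h.+1%:R%:E <= agree_sup y y)%E by apply: agree_sup_ge.
have fin : agree_sup y y \is a fin_num.
  by rewrite ge0_fin_numE// agree_sup_ge0.
have := A (Num.truncn (fine (agree_sup y y))).
by rewrite -[X in (_ <= X)%E](fineK fin) lee_fin leNgt truncnS_gt.
Qed.

Lemma local_dist_refl x : local_dist x x = 0.
Proof. by rewrite /local_dist (agree_sup_pinfty x x).2. Qed.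

Lemma local_dist_positivity x y : local_dist x y = 0 -> x = y.
Proof.
move=> e; apply/agree_sup_pinfty; move: e (agree_sup_ge0 x y).
rewrite /local_dist; case: agree_sup => [r||] //= /eqP.
by rewrite powR_eq0 (_ : 2 == 0 = false)// pnatr_eq0.
Qed.

Lemma local_dist_sym x y : local_dist x y = local_dist y x.
Proof.
rewrite /local_dist /agree_sup (_ : agree x y = agree y x)//.
by apply/seteqP; split=> h [? e]; split.
Qed.

Lemma local_dist_triangle y x z :
  local_dist x z <= local_dist x y + local_dist y z.
Proof.
have := agree_sup_ultra y x z; rewrite ge_min => /orP[]/exp2N_anti;
  move=> /(_ (agree_sup_ge0 _ _))/le_trans; apply.
  by rewrite lerDl exp2N_ge0.
by rewrite lerDr exp2N_ge0.
Qed.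

End LocalDistance.

HB.instance Definition _ := gen_eqMixin rooted_perm.
HB.instance Definition _ := gen_choiceMixin rooted_perm.

(* The parameter R, the field in which distances take their values, is needed *)
(* for type inference only.                                                   *)
Definition rooted_space (R : realType) : Type := rooted_perm.

HB.instance Definition _ (R : realType) := Choice.on (rooted_space R).
HB.instance Definition _ (R : realType) :=
  isPointed.Build (rooted_space R) (rooted (1 : 'S_1)%g ord0).
HB.instance Definition _ (R : realType) := isMetric.Build R (rooted_space R)
  (@local_dist_refl R) (@local_dist_positivity R) (@local_dist_sym R)
  (@local_dist_triangle R).

HB.instance Definition _ (T : finType) := isPointed.Build (perm_type T) 1%g.
HB.instance Definition _ (T : finType) :=
  @isMeasurable.Build default_measure_display (perm_type T) discrete_measurable
    discrete_measurable0 discrete_measurableC discrete_measurableU.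

HB.instance Definition _ n := isPointed.Build 'I_n.+1 ord0.
HB.instance Definition _ n :=
  @isMeasurable.Build default_measure_display 'I_n.+1 discrete_measurable
    discrete_measurable0 discrete_measurableC discrete_measurableU.

Notation borel T := (g_sigma_algebraType (@open T)).

Section Uniform.
Variables (R : realType) (n : nat).

Definition uniform_index : set 'I_n.+1 -> \bar R :=
  mscale (n.+1%:R^-1)%:nng (msum (fun k => dirac (inord k : 'I_n.+1)) n.+1).

HB.instance Definition _ := Measure.on uniform_index.

Let uniform_index_setT : uniform_index setT = 1%E.
Proof.
rewrite /uniform_index /mscale /= /msum /=.
under eq_bigr do rewrite diracT.
by rewrite sumEFin sumr_const card_ord -EFinM mulVf// pnatr_eq0.
Qed.

HB.instance Definition _ :=
  Measure_isProbability.Build _ _ _ uniform_index uniform_index_setT.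

End Uniform.

Section WeakTopology.
Variables (R : realType) (T : ptopologicalType).

Definition bounded_continuous : Type :=
  {f : T -> R | continuous f /\ bounded_fun f}.

HB.instance Definition _ := gen_eqMixin bounded_continuous.
HB.instance Definition _ := gen_choiceMixin bounded_continuous.

Definition weak_eval (mu : probability (borel T) R) :
    {ptws bounded_continuous -> R} :=
  fun f => (\int[mu]_x (sval f x))%R.

Definition weak_probability : Type := initial_topology weak_eval.

HB.instance Definition _ :=
  PointedTopological.copy weak_probability (initial_topology weak_eval).

End WeakTopology.

(* X n and Y may live on different probability spaces. They are meant to be   *)
(* such that the compositions with continuous functions are measurable.       *)
Definition cvg_in_distribution (R : realType) (S : topologicalType)
    (d : nat -> measure_display) (T : forall n, measurableType (d n))
    (P : forall n, probability (T n) R) (X : forall n, T n -> S)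
    (d' : measure_display) (T' : measurableType d') (Q : probability T' R)
    (Y : T' -> S) : Prop :=
  forall f : S -> R, continuous f -> bounded_fun f ->
    ('E_(P n)[f \o X n] @[n --> \oo] --> 'E_Q[f \o Y])%E.

Section BenjaminiSchramm.
Variable R : realType.

Section RootedLaw.
Variables (n : nat) (s : 'S_n.+1).

Definition rooted_at (i : 'I_n.+1) : borel (rooted_space R) := rooted s i.

Let measurable_rooted_at : measurable_fun [set: 'I_n.+1] rooted_at.
Proof. by []. Qed.

HB.instance Definition _ :=
  isMeasurableFun.Build _ _ _ _ rooted_at measurable_rooted_at.

Definition rooted_law : weak_probability R (rooted_space R) :=
  distribution (@uniform_index R n) rooted_at.

End RootedLaw.

Variables (d : nat -> measure_display) (T : forall n, measurableType (d n)).
Variables (P : forall n, probability (T n) R).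
Variables (sigma : forall n, {RV (P n) >-> 'S_n.+1}).

(* The index i_n is the second projection on T n * 'I_n.+1: it is uniform     *)
(* conditionally on the first one, hence conditionally on sigma n.            *)
Definition annealed_BS_cvg : Prop :=
  exists (d' : measure_display) (T' : measurableType d') (Q : probability T' R)
      (X : {RV Q >-> borel (rooted_space R)}),
    cvg_in_distribution (S := rooted_space R)
      (fun n => (P n \x @uniform_index R n)%E : probability _ R)
      (fun n (w : T n * 'I_n.+1) => rooted (sigma n w.1) w.2) Q X.

Definition quenched_BS_cvg : Prop :=
  exists (d' : measure_display) (T' : measurableType d') (Q : probability T' R)
      (M : {RV Q >-> borel (weak_probability R (rooted_space R))}),
    cvg_in_distribution P (fun n w => rooted_law (sigma n w)) Q M.

End BenjaminiSchramm.

(* Main.v *)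
(* The space of rooted permutations is a compact ultrametric space, whose       *)
(* topology is generated by the restrictions to [-h, h], finitely many for each *)
(* h. By compactness, a finitely additive set function on the algebra of sets   *)
(* determined by such a restriction extends to a Borel measure; taking limits   *)
(* along ultrafilters, the space W of probability measures is compact in the    *)
(* weak topology, and measures converge as soon as their values on these sets   *)
(* converge.                                                                    *)
(* The frequency of a pattern p in a permutation s is exactly the mass, under   *)
(* the law of the rooted s, of the event that p occurs with the root as its     *)
(* first entry, and equally with the root at any other fixed entry. Hence the   *)
(* mass of an event determined by the restriction to [-h, h] is a sum of        *)
(* pattern frequencies, up to an error of order h/n caused by roots close to    *)
(* the boundary. This gives (a).                                                *)
(* For (b), let Z be the compact set of measures satisfying these relations     *)
(* without error. On Z a measure is determined by its vector of pattern masses, *)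
(* and a continuous function on W vanishing on Z is uniformly small on the laws *)
(* of large rooted permutations. So the limiting vector Lambda almost surely    *)
(* lies in the compact image K of Z, it lifts measurably to Z, and Tietze's     *)
(* theorem extends continuous functions of the lift from K to all vectors.      *)

From HB Require Import structures.
Require Import Defs.
From mathcomp Require Import finmap all_boot all_order all_algebra all_fingroup.
From mathcomp Require Import all_classical all_reals all_analysis.
From mathcomp Require Import measurable_realfun zify lra.

Set Implicit Arguments.
Unset Strict Implicit.
Unset Printing Implicit Defensive.

Import Order.TTheory GRing.Theory Num.Theory.
Import numFieldNormedType.Exports.

Local Open Scope classical_set_scope.
Local Open Scope ring_scope.

(** * Occurrences of patterns around the root *)

(** Two ingredients carry the proof, a count and compactness. The count is [card_window_pat]:
    whichever entry carries the root, a pattern has as many roots as consecutive occurrences. Hence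
    level masses and pattern frequencies of a permutation of size n + 1 differ by at most 2h/(n + 1)
    ([defect_rooted_law]). Compactness is [weak_probability_compact], and [weak_level_cvg] reduces
    weak convergence to level masses. For (a), limits of the mean frequencies fix the level masses
    of every cluster point of the annealed laws; conversely, pattern events are clopen. For (b), one
    direction is the continuity of [pattern_mass]. In the other, [vanish_limit_set] turns a test
    function of the measure into an asymptotic function of the frequencies, [clamped_limit_pattern]
    places the limit vector in the image of the limit set, and [limit_set_indistinguishable] makes
    the lift independent of choices. The last implication tests quenched convergence against single
    coordinates of [pattern_mass] and applies (a). *)

Section Windows.
Variable k : nat.
Implicit Types p : 'S_k.+1.

(* The pattern p occurs with the root at its entry c, counted from 0.           *)
Definition window_pat p (c : nat) : set rooted_perm :=
  [set x | forall a b : 'I_k.+1,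
    rp_le x (a%:Z - c%:Z) (b%:Z - c%:Z) <-> (p a <= p b)%N].

Variable n : nat.
Implicit Types s : 'S_n.+1.

Definition occurs_at p s (j : nat) : bool :=
  (j + k <= n)%N && [forall a : 'I_k.+1, [forall b : 'I_k.+1,
    (s (inord (j + a)) <= s (inord (j + b)))%N == (p a <= p b)%N]].

Definition window (j : nat) : {set 'I_n.+1} :=
  [set i : 'I_n.+1 | (j <= i <= j + k)%N]%SET.

Lemma inord_window (j : nat) (a : 'I_k.+1) : (j + k <= n)%N ->
  (inord (j + a) : 'I_n.+1) = (j + a)%N :> nat.
Proof. by move=> jk; rewrite inordK// ltnS; have := ltn_ord a; lia. Qed.

Lemma window_pat_rooted p s (c : nat) (i : 'I_n.+1) : (c <= k)%N ->
  window_pat p c (rooted s i) <-> (c <= i)%N /\ occurs_at p s (i - c).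
Proof.
move=> ck; split.
  (* Comparing [a] with itself forces every position of the window into the domain. *)
  move=> V; have /= W (a : 'I_k.+1) : exists u : 'I_n.+1, u%:Z = a%:Z - c%:Z + i%:Z.
    by have [u [v [ua _ _]]] := (V a a).2 (leqnn _); exists u.
  have ci : (c <= i)%N by have [u /= hu] := W ord0; lia.
  have ikn : (i - c + k <= n)%N.
    by have [u /= hu] := W ord_max; have := ltn_ord u; lia.
  split=> //; apply/andP; split=> //; apply/forallP => a; apply/forallP => b.
  apply/eqP; apply/idP/idP => [le|/V[u [v [ua vb]]]].
    apply/V; exists (inord (i - c + a)), (inord (i - c + b)); split => //.
      by rewrite inord_window//; lia.
    by rewrite inord_window//; lia.
  have -> : u = inord (i - c + a) by apply/val_inj; rewrite /= inord_window//; lia.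
  by have -> : v = inord (i - c + b) by apply/val_inj; rewrite /= inord_window//; lia.
move=> [ci /andP[ikn /forallP o]] a b; have /forallP/(_ b)/eqP <- := o a.
split=> [[u [v [ua vb]]]|le].
  have -> : u = inord (i - c + a) by apply/val_inj; rewrite /= inord_window//; lia.
  by have -> : v = inord (i - c + b) by apply/val_inj; rewrite /= inord_window//; lia.
exists (inord (i - c + a)), (inord (i - c + b)); split => //.
  by rewrite inord_window//; lia.
by rewrite inord_window//; lia.
Qed.

Lemma enum_window (j : nat) : (j + k <= n)%N ->
  map val (enum (window j)) = iota j k.+1.
Proof.
move=> jk; apply: (@irr_sorted_eq _ ltn); [exact: ltn_trans|exact: ltnn| | |].
- rewrite sorted_map; apply: sorted_filter; first by move=> ? ? ?; exact: ltn_trans.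
  by rewrite -sorted_map -enumT val_enum_ord iota_ltn_sorted.
- exact: iota_ltn_sorted.
- move=> a; rewrite mem_iota; apply/mapP/idP => [[i]|ja].
    by rewrite mem_enum inE => /andP[? ?] -> /=; lia.
  have an : (a < n.+1)%N by lia.
  by exists (Ordinal an); rewrite // mem_enum inE /=; lia.
Qed.

Lemma card_window (j : nat) : (j + k <= n)%N -> #|window j| = k.+1.
Proof. by move=> jk; rewrite cardE -(size_map val) enum_window// size_iota. Qed.

Lemma enum_val_window (j : nat) (a : 'I_#|window j|) : (j + k <= n)%N ->
  enum_val a = (j + a)%N :> nat.
Proof.
move=> jk; rewrite /enum_val -(nth_map _ 0%N) -?cardE// enum_window// nth_iota//.
by rewrite -(card_window jk).
Qed.

(** Each value of a permutation is the number of entries with a smaller value, so it can be read off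
    the order. *)
Lemma perm_order_inj (m : nat) (p q : 'S_m) :
  (forall a b, (p a <= p b)%N = (q a <= q b)%N) -> p = q.
Proof.
move=> pq; apply/permP => a; apply/val_inj => /=.
have rank (u : 'S_m) (b : 'I_m) : #|[set c | (u c < u b)%N]%SET| = u b.
  rewrite -[LHS](card_imset _ (@perm_inj _ u)).
  rewrite (_ : u @: _ = [set c : 'I_m | (c < u b)%N]%SET); last first.
    apply/setP => c; rewrite inE; apply/imsetP/idP => [[d]|cb].
      by rewrite inE => ? ->.
    by exists ((u^-1)%g c); rewrite ?inE permKV.
  rewrite cardsE cardE size_filter -enumT.
  rewrite (eq_count (a2 := preim val (fun c => c < u b)%N))//.
  rewrite -count_map val_enum_ord.
  have := ltn_ord (u b); move: (u b : nat) => v vm.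
  rewrite -(subnKC (ltnW vm)) iotaD count_cat add0n.
  rewrite (@eq_in_count _ _ predT) ?count_predT ?size_iota; last first.
    by move=> x; rewrite mem_iota => /andP[_]; rewrite add0n => ->.
  rewrite (@eq_in_count _ _ pred0) ?count_pred0 ?addn0//.
  by move=> x; rewrite mem_iota => /andP[? _] /=; lia.
by rewrite -rank -[RHS]rank; apply: eq_card => c; rewrite !inE !ltnNge pq.
Qed.

Lemma existT_perm_eq (m : nat) (q : 'S_m) (p : 'S_k.+1) (mk : m = k.+1) :
  (existT (fun k => 'S_k) m q == existT (fun k => 'S_k) k.+1 p) =
  [forall a : 'I_k.+1, [forall b : 'I_k.+1,
    (q (cast_ord (esym mk) a) <= q (cast_ord (esym mk) b))%N ==
    (p a <= p b)%N]].
Proof.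
subst m; apply/eqP/idP => [|/forallP qp].
  move/(@Eqdep_dec.inj_pair2_eq_dec _ (@eq_comparable _) (fun k => 'S_k)) => ->.
  by apply/forallP => a; apply/forallP => b; rewrite !cast_ord_id.
congr existT; apply: perm_order_inj => a b.
by have /forallP/(_ b)/eqP <- := qp a; rewrite !cast_ord_id.
Qed.

Lemma pat_window_eq p s (j : nat) : (j + k <= n)%N ->
  (existT (fun k => 'S_k) #|window j| (pat (window j) s) ==
    existT (fun k => 'S_k) k.+1 p) = occurs_at p s j.
Proof.
move=> jk; rewrite (existT_perm_eq _ _ (card_window jk)) /occurs_at jk /=.
have E c : enum_val (cast_ord (esym (card_window jk)) c) = inord (j + c).
  by apply/val_inj; rewrite /= enum_val_window// inord_window.
apply: eq_forallb => a; apply: eq_forallb => b.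
by rewrite [(pat _ _ _ <= _)%N]leqNgt pat_lt -leqNgt !E.
Qed.

End Windows.

Lemma interval_window (k n : nat) (I : {set 'I_n.+1}) :
  Defs.is_interval I -> #|I| = k.+1 ->
  exists2 j : 'I_n.+1, (j + k <= n)%N & I = window k n j.
Proof.
move=> /existsP[a /existsP[b /eqP IE]] cI.
have ab : (a <= b)%N.
  rewrite leqNgt; apply/negP => ba.
  have /card_gt0P[i] : (0 < #|I|)%N by rewrite cI.
  by rewrite IE inE => ?; lia.
have IE' : I = window (b - a) n a.
  by rewrite IE; apply/setP => i; rewrite !inE subnKC.
have abn : (a + (b - a) <= n)%N by have := ltn_ord b; lia.
have ck : (b - a)%N = k by have := card_window abn; rewrite -IE'; lia.
by exists a; rewrite -?ck.
Qed.

Lemma c_occ_occurs_at (k n : nat) (p : 'S_k.+1) (s : 'S_n.+1) :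
  c_occ (existT _ k p) s = #|[set j : 'I_n.+1 | occurs_at p s j]%SET|.
Proof.
rewrite -(card_in_imset (f := fun j : 'I_n.+1 => window k n j)); last first.
  move=> i j; rewrite !inE => /andP[ik _] /andP[jk _] ij.
  have : i \in window k n j by rewrite -ij inE; lia.
  have : j \in window k n i by rewrite ij inE; lia.
  by rewrite !inE => ? ?; apply/val_inj => /=; lia.
rewrite /c_occ; apply: eq_card => I; rewrite !inE.
apply/andP/imsetP => [[Iint Ip]|[j]]; last first.
  rewrite inE => js ->; have /andP[jk _] := js.
  split; last by rewrite pat_window_eq.
  apply/existsP; exists j; apply/existsP; exists (inord (j + k)).
  by apply/eqP/setP => i; rewrite !inE inordK//.
have cI : #|I| = k.+1 by move/eqP : (Ip) => /(congr1 (@projT1 _ _)).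
have [j jk IE] := interval_window Iint cI; exists j => //.
by rewrite inE -pat_window_eq// -IE.
Qed.

(** Shifting by [c] matches starting positions of occurrences with roots, so the count does not
    depend on [c]. This is the invariance under re-rooting that survives in the limit. *)
Lemma card_window_pat (k n : nat) (p : 'S_k.+1) (c : nat) (s : 'S_n.+1) :
  (c <= k)%N ->
  #|[set i : 'I_n.+1 | `[< window_pat p c (rooted s i) >] ]%SET| =
  c_occ (existT _ k p) s.
Proof.
move=> ck; rewrite c_occ_occurs_at.
rewrite -(card_in_imset (f := fun j : 'I_n.+1 => (inord (j + c) : 'I_n.+1))
    (D := [set j : 'I_n.+1 | occurs_at p s j]%SET)); last first.
  move=> i j; rewrite !inE => /andP[ik _] /andP[jk _] /(congr1 val) /=.
  have jc (l : nat) : (l + k <= n)%N -> (l + c < n.+1)%N by lia.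
  by rewrite !inordK ?jc// => /addIn/val_inj.
apply: eq_card => i; rewrite !inE; apply/asboolP/imsetP.
  move=> /(window_pat_rooted _ _ _ ck)[ci o].
  have ic : (i - c < n.+1)%N by have := ltn_ord i; lia.
  by exists (Ordinal ic); rewrite ?inE//= subnK// inord_val.
move=> [j]; rewrite inE => o ->; apply/(window_pat_rooted _ _ _ ck).
have /andP[jk _] := o.
have jc : (j + c < n.+1)%N by lia.
by rewrite inordK// addnK; split => //; lia.
Qed.

(** * Finite codes of restrictions *)

Section Code.
Variable h : nat.

(* The order on [-h, h], shifted to {0, ..., 2h}. It also records the domain,   *)
(* since rp_le x a a holds exactly when a is in the domain of x.                *)
Definition code (x : rooted_perm) : {ffun 'I_h.*2.+1 * 'I_h.*2.+1 -> bool} :=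
  [ffun ab : 'I_h.*2.+1 * 'I_h.*2.+1 =>
    `[< rp_le x (ab.1%:Z - h%:Z) (ab.2%:Z - h%:Z) >] ].

Definition level e : set rooted_perm := [set x | code x = e].

Definition pat_code (p : 'S_h.*2.+1) : {ffun 'I_h.*2.+1 * 'I_h.*2.+1 -> bool} :=
  [ffun ab : 'I_h.*2.+1 * 'I_h.*2.+1 => (p ab.1 <= p ab.2)%N].

Lemma level_pat_code p : level (pat_code p) = window_pat p h.
Proof.
apply/seteqP; split=> x /=.
  move=> /ffunP xp a b; have := xp (a, b); rewrite !ffunE /= => <-.
  exact: (rwP (asboolP _)).
move=> xp; apply/ffunP => -[a b]; rewrite !ffunE /=.
by apply/asboolP/idP => /xp.
Qed.

Lemma codeE x (a b : int) (ha : (absz (a + h%:Z)%R < h.*2.+1)%N)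
    (hb : (absz (b + h%:Z)%R < h.*2.+1)%N) :
  - h%:Z <= a <= h%:Z -> - h%:Z <= b <= h%:Z ->
  code x (Ordinal ha, Ordinal hb) <-> rp_le x a b.
Proof.
move=> ah bh; rewrite ffunE /=.
have -> : `|(a + h%:Z)%R|%N%:Z - h%:Z = a :> int by lia.
have -> : `|(b + h%:Z)%R|%N%:Z - h%:Z = b :> int by lia.
by split=> /asboolP.
Qed.

Lemma code_restr x : code (restr h x) = code x.
Proof.
apply/ffunP => -[a b]; rewrite !ffunE /=.
have D (c : 'I_h.*2.+1) : - h%:Z <= c%:Z - h%:Z <= h%:Z by have := ltn_ord c; lia.
apply: asbool_equiv_eq; split=> [[]//|ab]; have [xa xb] := rp_le_dom ab.
by split => //; split => //=; exact: D.
Qed.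

Lemma code_eq x y : code x = code y <-> restr h x = restr h y.
Proof.
split=> [xy|xy]; last by rewrite -code_restr xy code_restr.
have L u v : code u = code v -> forall a b, restr_le h u a b -> restr_le h v a b.
  move=> uv a b [ab [_ /= ah] [_ /= bh]].
  have ha : (absz (a + h%:Z)%R < h.*2.+1)%N by lia.
  have hb : (absz (b + h%:Z)%R < h.*2.+1)%N by lia.
  have vab : rp_le v a b.
    by apply/(codeE _ ha hb ah bh); rewrite -uv; apply/codeE.
  by have [va vb] := rp_le_dom vab.
have le_eq : restr_le h x = restr_le h y.
  by apply/funext => a; apply/funext => b; apply/propext; split; apply: L.
apply: rooted_perm_eq => //=; apply/seteqP; split=> a.
  move=> /(@rp_le_refl (restr h x)) /=; rewrite le_eq.
  by move=> /(@rp_le_dom (restr h y))[].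
move=> /(@rp_le_refl (restr h y)) /=; rewrite -le_eq.
by move=> /(@rp_le_dom (restr h x))[].
Qed.

(* A restriction not coming from a permutation of size 2h + 1 misses part of    *)
(* [-h, h], so the root is at distance less than h from an end of s.            *)
Lemma card_level_boundary n (s : 'S_n.+1) e : (forall p, pat_code p <> e) ->
  (#|[set i : 'I_n.+1 | code (rooted s i) == e]%SET| <= h.*2)%N.
Proof.
move=> ep.
pose A := [set (inord a : 'I_n.+1) | a : 'I_h]%SET.
pose B := [set (inord (n - a) : 'I_n.+1) | a : 'I_h]%SET.
have ABh : (#|A :|: B| <= h.*2)%N.
  rewrite (leq_trans (leq_card_setU _ _))// -addnn.
  by rewrite leq_add// (leq_trans (leq_imset_card _ _))// card_ord.
apply: leq_trans ABh; apply: subset_leq_card; apply/fintype.subsetP => i.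
rewrite !inE => /eqP ie.
have [ih|hi] := ltnP i h.
  by apply/orP; left; apply/imsetP; exists (Ordinal ih); rewrite //= inord_val.
have [ih|ihn] := ltnP (n - i) h.
  apply/orP; right; apply/imsetP; exists (Ordinal ih) => //=.
  by apply/val_inj; rewrite /= inordK; have := ltn_ord i; lia.
have jk : (i - h + h.*2 <= n)%N by have := ltn_ord i; lia.
(* Both ends are now at distance at least h from the root, so the restriction is the pattern of a
   full window and [e] would be its code. *)
pose q : 'S_h.*2.+1 := cast_perm (card_window jk) (pat (window h.*2 n (i - h)) s).
case: (ep q); rewrite -ie; symmetry.
suff : window_pat q h (rooted s i) by rewrite -level_pat_code.
apply/window_pat_rooted; first by lia.
split=> //; rewrite -pat_window_eq// (existT_perm_eq _ _ (card_window jk)).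
apply/forallP => a; apply/forallP => b; apply/eqP.
by rewrite !cast_permE.
Qed.
End Code.
Lemma code_le h k x y : (h <= k)%N -> code k x = code k y -> code h x = code h y.
Proof.
move=> hk /code_eq xy; apply/code_eq.
by rewrite -(restr_restr x hk) -(restr_restr y hk) xy.
Qed.

(** * Compactness of the space of rooted permutations *)

Section RootedSpace.
Variable R : realType.
Local Notation S := (rooted_space R).

Lemma local_dist_lt_code h (x y : S) : code h x = code h y ->
  local_dist R x y <= 2 `^ (- h%:R).
Proof.
case: h => [_|h /code_eq xy].
  rewrite oppr0 powRr0 -[leRHS](powRr0 2) -[X in _ `^ X]oppr0.
  exact: (@exp2N_anti R 0%E (agree_sup R x y)) (agree_sup_ge0 R x y).
have : agree x y h.+1 by [].
by move=> /(agree_sup_ge R)/(exp2N_anti _); apply.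
Qed.

Lemma nbhs_codeP (x : S) (A : set S) :
  nbhs x A <-> exists h, forall y, code h y = code h x -> A y.
Proof.
split=> [/nbhs_ballP[e /= e0 xA]|[h xA]].
  have [h he] : exists h : nat, 2 `^ (- h%:R) < e.
    have [h _ /(_ h (leqnn h)) /=] := near_infty_natSinv_expn_lt (PosNum e0).
    by exists h; rewrite powRN powR_mulrn// -div1r.
  exists h => y xy; apply: xA; rewrite ballEmdist /=.
  by apply: le_lt_trans he; apply: local_dist_lt_code; rewrite xy.
apply/nbhs_ballP; exists (2 `^ (- h%:R)); first by rewrite /= powR_gt0.
move=> y; rewrite ballEmdist /= => xy; apply: xA; symmetry.
have : (h%:R%:E < agree_sup R x y)%E.
  rewrite ltNge; apply/negP => /(exp2N_anti (agree_sup_ge0 _ _ _)) /=.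
  by rewrite leNgt xy.
move=> /agree_sup_gt[|k [_ xyk]]; rewrite ?lee_fin// lte_fin ltr_nat => hk.
by apply/(code_le (ltnW hk))/code_eq.
Qed.

(** Along an ultrafilter, each assertion that a position is present or that one precedes another
    eventually holds or eventually fails. The eventual truths satisfy the axioms of a rooted
    permutation, which is the limit. *)
Lemma rooted_space_compact : compact [set: S].
Proof.
rewrite compact_ultra => F FU _.
have FP : ProperFilter F by exact: ultra_proper.
pose A : set int := [set a | F [set x | rp_dom x a]].
pose L a b := F [set x | rp_le x a b].
have A0 : A 0 by apply: filterS filterT => x _; exact: rp_dom0.
have Aint a b c : A a -> A c -> a <= b <= c -> A b.
  move=> Aa Ac abc; apply: filterS2 Aa Ac => x xa xc.
  exact: rp_dom_interval xa xc abc.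
have LA a b : L a b -> A a /\ A b.
  by move=> ab; split; apply: filterS ab => x /rp_le_dom[].
have Lrefl a : A a -> L a a.
  by apply: filterS => x; exact: rp_le_refl.
have Lanti a b : L a b -> L b a -> a = b.
  move=> ab ba; have [x [xab xba]] := filter_ex (filterI ab ba).
  exact: rp_le_anti xab xba.
have Ltrans a b c : L a b -> L b c -> L a c.
  by apply: filterS2 => x; exact: rp_le_trans.
have Ltotal a b : A a -> A b -> L a b \/ L b a.
  move=> Aa Ab; have [|nab] := in_ultra_setVsetC [set x | rp_le x a b] FU.
    by left.
  right; apply: filterS3 Aa Ab nab => x xa xb /= nab.
  by have [/nab|] := rp_le_total xa xb.
pose y : S := RootedPerm A0 Aint LA Lrefl Lanti Ltrans Ltotal.
exists y; split => // U /nbhs_codeP[h hU].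
have : \forall x \near F, forall ab, code h x ab = code h y ab.
  apply: filter_forall => -[a b].
  set a' : int := a%:Z - h%:Z; set b' : int := b%:Z - h%:Z.
  have [ab|nab] := in_ultra_setVsetC [set x | rp_le x a' b'] FU.
    apply: filterS (ab) => x xab; rewrite !ffunE /=.
    by rewrite (asboolT xab) (asboolT (ab : rp_le y a' b')).
  apply: filterS (nab) => x xab; rewrite !ffunE /=.
  rewrite (asboolF xab) asboolF// => ab.
  by have [? []] := filter_ex (filterI ab nab).
by apply: filterS => x xy; apply: hU; apply/ffunP.
Qed.

(** Uniform continuity from the near-covering form of compactness. A radius found at one point
    serves its whole level set, since the space is ultrametric. *)
Lemma continuous_code_uniform (f : S -> R) (e : R) : continuous f -> 0 < e ->
  exists h, forall x y, code h x = code h y -> `|f x - f y| < e.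
Proof.
move=> cf e0.
have /compact_near_coveringP := rooted_space_compact.
move=> /(_ nat \oo (fun h x => forall y, code h x = code h y -> `|f x - f y| < e)).
case=> [x _|h _ /(_ h (leqnn _)) H]; last first.
  by exists h => x y; apply: H.
have e2 : 0 < e / 2 by rewrite divr_gt0.
have /cvgrPdist_lt/(_ _ e2)/nbhs_codeP[h hx] := cf x.
exists (level (code h x), [set k | (h <= k)%N]) => /=.
  split; last by exists h.
  by apply/nbhs_codeP; exists h.
move=> [y k] /= [yx hk] z yz.
have zx : code h z = code h x by rewrite -yx; apply/esym/(code_le hk).
rewrite (le_lt_trans (ler_distD (f x) _ _))// [e]splitr ltrD//; last exact: hx.
by rewrite distrC; exact: hx.
Qed.
End RootedSpace.
(** * Generalities on topology and integration *)

Section PointwiseTopology.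

Lemma initial_cvgP (S : choiceType) (T : topologicalType) (f : S -> T)
    (F : set_system S) (s : S) : Filter F ->
  F --> (s : initial_topology f) <-> f @ F --> f s.
Proof.
move=> FF; split=> [Fs|Ffs].
  by apply: cvg_trans (@initial_continuous _ _ f s); exact: cvg_app Fs.
move=> A [_ [[B oB <-] Bs BA]]; apply: filterS BA _; apply: Ffs.
exact: open_nbhs_nbhs.
Qed.

Lemma ptws_cvgP (I : Type) (V : topologicalType) (F : set_system (I -> V))
    (f : {ptws I -> V}) : Filter F ->
  F --> f <-> forall i, g i @[g --> F] --> f i.
Proof.
move=> FF; split=> [/cvg_sup Ff i|Ff].
  by have /initial_cvgP := Ff i; apply.
by apply/cvg_sup => i; apply/initial_cvgP; exact: Ff.
Qed.

End PointwiseTopology.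

Lemma ultra_cvg_unit (R : realType) (T : Type) (F : set_system T) (f : T -> R) :
  UltraFilter F -> (forall x, 0 <= f x <= 1) -> cvg (f @ F).
Proof.
move=> FU f01; have FP : ProperFilter F by exact: ultra_proper.
have f01F : (f @ F) `[0, 1]%classic.
  by apply: (@filterS _ F _ setT) filterT => x _; rewrite /= in_itv /= f01.
have [l [_ fl]] := @segment_compact R 0 1 (f @ F) _ f01F.
apply/cvg_ex; exists l => A lA.
have [//|nA] := in_ultra_setVsetC (f @^-1` A) FU.
by have [y []] := fl (~` A) A nA lA.
Qed.

Lemma bounded_fun_leP (R : realType) (T : Type) (f : T -> R) :
  bounded_fun f <-> exists M, forall x, `|f x| <= M.
Proof.
split=> [[M [_ Mf]]|[M fM]].
  by exists (M + 1) => x; apply: Mf; rewrite ?ltrDl.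
by exists M; split; rewrite ?num_real// => N MN x _; exact/ltW/(le_lt_trans _ MN).
Qed.

Lemma bounded_fun_indic (R : realType) (T : Type) (A : set T) :
  bounded_fun (\1_A : T -> R).
Proof.
apply/bounded_fun_leP; exists 1 => x; rewrite indicE.
by case: (_ \in _); rewrite ?normr1// normr0.
Qed.

Section BorelProbability.
Variables (R : realType) (T : ptopologicalType).

Lemma measurable_open (A : set T) : open A -> measurable (A : set (borel T)).
Proof. by move=> oA; apply: sub_sigma_algebra. Qed.

Lemma continuous_borel_measurable (f : T -> R) :
  continuous f -> measurable_fun [set: borel T] (f : borel T -> R).
Proof.
move=> /continuousP cf.
apply: (measurability _ (RGenOpens.measurableE R)) => _ [_ [a [b ->]] <-].
by rewrite setTI; apply: measurable_open; apply: cf; exact: interval_open.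
Qed.

End BorelProbability.

Lemma bounded_integrable (R : realType) d (T : measurableType d)
    (P : probability T R) (f : T -> R) :
  measurable_fun [set: T] f -> bounded_fun f ->
  P.-integrable [set: T] (EFin \o f).
Proof.
move=> mf bf; apply: measurable_bounded_integrable => //.
by rewrite (le_lt_trans (probability_le1 P measurableT))// ltry.
Qed.

Lemma Rintegral_close (R : realType) d (T : measurableType d)
    (P : probability T R) (f g : T -> R) (e : R) :
  measurable_fun [set: T] f -> bounded_fun f ->
  measurable_fun [set: T] g -> bounded_fun g ->
  (forall x, `|f x - g x| <= e) ->
  `|(\int[P]_x f x)%R - (\int[P]_x g x)%R| <= e.
Proof.
move=> mf bf mg bg fg.
have intf := bounded_integrable P mf bf; have intg := bounded_integrable P mg bg.
rewrite -RintegralB// (le_trans (le_normr_Rintegral _ _))//.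
  exact: (integrableB _ intf intg).
have -> : e = (\int[P]_(x in setT) e)%R.
  by rewrite Rintegral_cst// [X in fine X](probability_setT P) mulr1.
apply: le_Rintegral => //.
- exact: (integrable_norm (integrableB _ intf intg)).
- by apply: bounded_integrable => //; apply/bounded_fun_leP; exists `|e|.
Qed.
(** * Extension of measures from cylinders *)

Definition cylinder : set (set rooted_perm) :=
  [set A | exists h, forall x y, code h x = code h y -> A x -> A y].

Lemma cylinder0 : cylinder set0. Proof. by exists 0%N. Qed.

Lemma cylinderC : setC_closed cylinder.
Proof.
move=> A [h Ah]; exists h => x y xy /= nAx Ay; apply: nAx.
exact: Ah (esym xy) Ay.
Qed.

Lemma cylinderU : setU_closed cylinder.
Proof.
move=> A B [h Ah] [k Bk]; exists (maxn h k) => x y xy [Ax|Bx].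
  by left; apply: Ah Ax; apply: code_le xy; exact: leq_maxl.
by right; apply: Bk Bx; apply: code_le xy; exact: leq_maxr.
Qed.

(** A copy of [rooted_perm] whose measurable sets are the cylinders, on which the extension theorem
    is run before passing to the Borel sets. *)
Definition cylinder_algebra : Type := rooted_perm.

HB.instance Definition _ := Choice.on cylinder_algebra.
HB.instance Definition _ :=
  isPointed.Build cylinder_algebra (rooted (1 : 'S_1)%g ord0).
HB.instance Definition _ :=
  @isAlgebraOfSets.Build default_measure_display cylinder_algebra
    cylinder cylinder0 cylinderU cylinderC.

Lemma level_cylinder h e : cylinder (@level h e).
Proof. by exists h => x y xy <-. Qed.

Section CylinderExtension.
Variable R : realType.
Local Notation S := (rooted_space R).

Lemma cylinder_open (A : set S) : cylinder A -> open A.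
Proof.
move=> [h Ah]; rewrite openE => x Ax; apply/nbhs_codeP; exists h => y yx.
exact: Ah (esym yx) Ax.
Qed.

(** The sets [F n] and the complement of their union form an open cover; a finite subcover leaves
    nothing for the other disjoint pieces. So finite additivity on cylinders already gives
    sigma-additivity. *)
Lemma cylinder_disjoint_finite (F : nat -> set S) :
  (forall i, cylinder (F i)) -> trivIset setT F -> cylinder (\bigcup_n F n) ->
  exists N, forall i, (N <= i)%N -> F i = set0.
Proof.
move=> cF tF cU; have /compact_near_coveringP := @rooted_space_compact R.
move=> /(_ nat \oo (fun n x => (\bigcup_n F n) x -> exists2 i, (i < n)%N & F i x)).
case=> [x _|N _ /(_ N (leqnn N)) H]; last first.
  exists N => i Ni; rewrite -subset0 => x Fix.
  have [|j jN Fjx] := H x I; first by exists i.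
  have ij : i = j by apply: tF => //; exists x.
  by move: jN; rewrite -ij ltnNge Ni.
have [[n _ Fnx]|nUx] := pselect ((\bigcup_n F n) x).
  exists (F n, [set m | (n < m)%N]).
    split=> /=; last by exists n.+1.
    by apply: open_nbhs_nbhs; split => //; exact: cylinder_open.
  by move=> [y m] /= [Fny nm] _; exists n.
exists (~` (\bigcup_n F n), setT).
  split=> /=; last exact: filterT.
  by apply: open_nbhs_nbhs; split => //; exact/cylinder_open/cylinderC.
by move=> [y m] /= [].
Qed.

Variable m : set rooted_perm -> R.
Hypothesis m_ge0 : forall A, 0 <= m A.
Hypothesis mT : m setT = 1.
Hypothesis m_add : forall A B, cylinder A -> cylinder B -> A `&` B = set0 ->
  m (A `|` B) = m A + m B.

Let mu (A : set cylinder_algebra) : \bar R := (m A)%:E.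

Let mu0 : mu set0 = 0%E.
Proof.
have := m_add cylinder0 cylinder0 (setI0 _).
by rewrite setU0 /mu => m0; congr EFin; lra.
Qed.

Let mu_ge0 A : (0 <= mu A)%E. Proof. by rewrite lee_fin. Qed.

Let mu_additive : measure_function.additive mu.
Proof.
rewrite -semi_additiveE; apply/additive2P => // A B mA mB AB.
by rewrite /mu m_add.
Qed.

Let mu_sigma_additive : semi_sigma_additive mu.
Proof.
move=> F mF tF mUF; have [N FN] := cylinder_disjoint_finite mF tF mUF.
have FUN n : (N <= n)%N -> \bigcup_i F i = \big[setU/set0]_(i < n) F i.
  move=> Nn; rewrite -bigcup_mkord; apply/seteqP; split=> x [i _ Fix].
    have [iN|Ni] := ltnP i N; first by exists i => //=; exact: leq_trans Nn.
    by rewrite FN in Fix.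
  by exists i.
apply: cvg_near_cst.
by exists N => // n /= Nn; rewrite big_mkord -mu_additive// -FUN.
Qed.

HB.instance Definition _ := isMeasure.Build _ _ _ mu mu0 mu_ge0 mu_sigma_additive.

Let nu := measure_extension mu.
HB.instance Definition _ := Measure.on nu.

Lemma cylinder_extension : exists P : probability (borel S) R,
  forall A, cylinder A -> P A = (m A)%:E.
Proof.
have mid : measurable_fun setT
    (id : g_sigma_algebraType (@measurable _ cylinder_algebra) -> borel S).
  apply: (@measurability _ _ _ (borel S) _ _ (@open S)) => [//|_ [A oA <-]].
  rewrite setTI preimage_id.
  (* An open set is a countable union of cylinders, so the generated sigma-algebra contains the
     Borel sets. *)
  rewrite (_ : A = \bigcup_h [set x | forall y, code h y = code h x -> A y]).
    apply: bigcupT_measurable => h; apply: sub_sigma_algebra; exists h => x y xy.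
    by move=> /= xA z zy; apply: xA; rewrite zy.
  apply/seteqP; split=> [x Ax|x [h _ hA]]; last exact: hA.
  have /nbhs_codeP[h hA] : nbhs (x : S) A by exact: open_nbhs_nbhs.
  by exists h.
have nuE A : cylinder A -> nu A = (m A)%:E.
  by move=> cA; rewrite /nu /measure_extension measurable_mu_extE.
have nuT : nu setT = 1%E.
  by rewrite nuE ?mT// -setC0; exact/cylinderC/cylinder0.
pose N : probability (g_sigma_algebraType (@measurable _ cylinder_algebra)) R :=
  HB.pack nu (Measure_isProbability.Build _ _ _ nu nuT).
pose X : {mfun g_sigma_algebraType (@measurable _ cylinder_algebra) >-> borel S} :=
  HB.pack (id : g_sigma_algebraType (@measurable _ cylinder_algebra) -> borel S)
    (isMeasurableFun.Build _ _ _ _ _ mid).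
by exists (distribution N X) => A cA; rewrite /= /distribution /pushforward /= nuE.
Qed.

End CylinderExtension.
(** * The weak topology on probability measures *)

Section WeakSpace.
Variable R : realType.
Local Notation S := (rooted_space R).
Local Notation W := (weak_probability R S).

Lemma code_continuous h (f : S -> R) :
  (forall x y, code h x = code h y -> f x = f y) -> continuous f.
Proof.
move=> fh x; have nfx : nbhs x [set y | f y = f x].
  by apply/nbhs_codeP; exists h => y; exact: fh.
exact: cvg_near_cst nfx.
Qed.

Lemma cylinder_indic_continuous (A : set S) :
  cylinder A -> continuous (\1_A : S -> R).
Proof.
move=> [h Ah]; apply: (@code_continuous h) => x y xy; rewrite !indicE.
congr (nat_of_bool _)%:R; apply/idP/idP; rewrite !inE; first exact: Ah.
exact: Ah (esym xy).
Qed.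

Lemma cylinder_measurable (A : set S) :
  cylinder A -> measurable (A : set (borel S)).
Proof. by move=> cA; apply: measurable_open; exact: cylinder_open. Qed.

Definition mass (A : set S) (mu : W) : R :=
  fine ((mu : probability (borel S) R) A).

Lemma Rintegral_indicE (P : probability (borel S) R) (A : set S) :
  cylinder A -> (\int[P]_x (\1_A x : R))%R = fine (P A).
Proof.
move=> cA; rewrite /Rintegral integral_indic ?setIT//.
exact: cylinder_measurable.
Qed.

Lemma weak_cvgP (F : set_system W) (mu : W) : Filter F ->
  F --> mu <-> forall f : bounded_continuous R S,
    weak_eval nu f @[nu --> F] --> weak_eval mu f.
Proof.
move=> FF; split=> [/initial_cvgP/ptws_cvgP //|Ff].
by apply/initial_cvgP/ptws_cvgP.
Qed.

Lemma weak_eval_continuous (f : bounded_continuous R S) :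
  continuous (fun mu : W => weak_eval mu f).
Proof. by move=> mu; have /weak_cvgP := @cvg_refl _ (nbhs mu); apply. Qed.

Lemma mass_continuous (A : set S) : cylinder A -> continuous (mass A).
Proof.
move=> cA mu; have cb : continuous (\1_A : S -> R) /\ bounded_fun (\1_A : S -> R).
  by split; [exact: cylinder_indic_continuous|exact: bounded_fun_indic].
have E : (fun nu : W => weak_eval nu (exist _ _ cb)) = mass A.
  by apply/funext => nu; exact: Rintegral_indicE.
by have := @weak_eval_continuous (exist _ _ cb) mu; rewrite E.
Qed.

Lemma mass_ge0 A (mu : W) : 0 <= mass A mu.
Proof. exact: fine_ge0. Qed.

Lemma mass_le1 A (mu : W) : cylinder A -> mass A mu <= 1.
Proof.
move=> cA; rewrite -[leRHS]/(fine (1%E : \bar R)); apply: fine_le => //.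
  by apply: fin_num_measure; exact: cylinder_measurable.
by apply: probability_le1; exact: cylinder_measurable.
Qed.

(* The default point when the level set is empty.                               *)
Definition level_point h a : S := xget point (@level h a : set S).

Lemma code_level_point h (x : S) : code h (level_point (code h x)) = code h x.
Proof. exact: (xgetI point (erefl : (level (code h x) : set S) x)). Qed.

Lemma Rintegral_levels h (c : _ -> R) (P : probability (borel S) R) :
  (\int[P]_x c (code h x))%R = \sum_e c e * fine (P (@level h e)).
Proof.
have intg (f : S -> R) : (forall x y, code h x = code h y -> f x = f y) ->
    P.-integrable [set: borel S] (EFin \o f).
  move=> fh; apply: bounded_integrable.
    by apply: continuous_borel_measurable; exact: code_continuous fh.
  apply/bounded_fun_leP.
  exists (\sum_e `|f (@level_point h e)|) => x.
  rewrite (bigD1 (code h x)) //= (fh x (level_point (code h x))).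
    by rewrite lerDl sumr_ge0.
  by rewrite code_level_point.
under eq_Rintegral => x _.
  rewrite (_ : c (code h x) = \sum_e c e * \1_(@level h e) x); last first.
    rewrite (bigD1 (code h x)) //= big1 ?addr0 ?indicE.
      by rewrite mem_set ?mulr1.
    by move=> e ex; rewrite indicE memNset ?mulr0// => xe; rewrite -xe eqxx in ex.
  over.
rewrite -big_enum /=; under eq_Rintegral do rewrite -big_enum /=.
elim: (enum _) => [|e s IH].
  under eq_Rintegral do rewrite big_nil.
  by rewrite big_nil Rintegral_cst// mul0r.
under eq_Rintegral do rewrite big_cons.
have lev e' x y : code h x = code h y -> \1_(@level h e') x = \1_(level e') y :> R.
  move=> xy; rewrite !indicE; congr (nat_of_bool _)%:R.
  by apply/idP/idP; rewrite !inE /level /= xy.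
rewrite RintegralD//; last 2 first.
- by apply: intg => x y xy; rewrite (lev _ _ _ xy).
- by apply: intg => x y xy; apply: eq_bigr => e' _; rewrite (lev _ _ _ xy).
rewrite RintegralZl//; last by apply: intg => x y; exact: lev.
by rewrite big_cons IH Rintegral_indicE//; exact: level_cylinder.
Qed.

Lemma weak_eval_approx (f : bounded_continuous R S) (e : R) : 0 < e ->
  exists h (c : _ -> R), forall mu : W,
    `|weak_eval mu f - \sum_a c a * mass (@level h a) mu| <= e.
Proof.
case: f => f [cf bf] e0; have [h fh] := continuous_code_uniform cf e0.
pose r := @level_point h; have rE := @code_level_point h.
exists h, (f \o r) => mu; rewrite /mass -Rintegral_levels /weak_eval /=.
have mf : measurable_fun [set: borel S] (f : borel S -> R).
  exact: continuous_borel_measurable.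
apply: (@Rintegral_close R _ (borel S) mu _ _ _ mf) => //.
- apply: continuous_borel_measurable; apply: (@code_continuous h).
  by move=> x y ->.
- by have /bounded_fun_leP[M fM] := bf; apply/bounded_fun_leP; exists M.
- by move=> x; rewrite ltW// fh// rE.
Qed.

(** A continuous function is uniformly close to a combination of indicators of levels, with an error
    that does not depend on the measure. *)
Lemma weak_level_cvg (F : set_system W) (mu : W) : Filter F ->
  (forall h a, mass (@level h a) nu @[nu --> F] --> mass (@level h a) mu) ->
  F --> mu.
Proof.
move=> FF Fl; apply/weak_cvgP => f; apply/cvgrPdist_lt => e e0.
have e3 : 0 < e / 3 by rewrite divr_gt0.
have [h [c fc]] := weak_eval_approx f e3.
have : \sum_a c a * mass (@level h a) nu @[nu --> F] -->
    \sum_a c a * mass (@level h a) mu.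
  apply: cvg_big => [|a _]; first exact: add_continuous.
  by apply: cvgM; [exact: cvg_cst|exact: Fl].
move=> /cvgrPdist_lt/(_ _ e3); apply: filterS => nu.
have := fc mu; have := fc nu; rewrite distrC.
set x := \sum_a _; set y := \sum_a _ => xf yf xy.
rewrite (le_lt_trans (ler_distD y _ _))//.
rewrite (_ : e = e / 3 + (e / 3 + e / 3)); last by lra.
rewrite ler_ltD// (le_lt_trans (ler_distD x _ _))// addrC ler_ltD//.
Qed.

Lemma weak_probability_compact : compact [set: W].
Proof.
rewrite compact_ultra => F FU _.
have FP : ProperFilter F by exact: ultra_proper.
have mcvg A : cylinder A -> cvg (mass A nu @[nu --> F]).
  by move=> cA; apply: ultra_cvg_unit => nu; rewrite mass_ge0 mass_le1.
(* The value 0 off the cylinders makes [m] nonnegative on all sets, as [cylinder_extension] asks. *)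
pose m (A : set rooted_perm) : R :=
  if pselect (cylinder A) then lim (mass A nu @[nu --> F]) else 0.
have mlim A : cylinder A -> mass A nu @[nu --> F] --> m A.
  move=> cA; rewrite /m; case: pselect => // cA'; exact: mcvg.
have [|||P Pm] := @cylinder_extension R m.
- move=> A; rewrite /m; case: pselect => // cA.
  by apply: limr_ge; [exact: mcvg|apply: nearW => nu; exact: mass_ge0].
- have cT : cylinder setT by rewrite -setC0; exact/cylinderC/cylinder0.
  have E : mass setT = cst 1 by apply/funext => nu; rewrite /mass probability_setT.
  have := mlim _ cT; rewrite E => m1.
  exact: (cvg_unique (@Rhausdorff R) m1 (cvg_cst _)).
- move=> A B cA cB AB.
  have mA := cylinder_measurable cA; have mB := cylinder_measurable cB.
  have E : mass (A `|` B) = (fun nu => mass A nu + mass B nu).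
    apply/funext => nu; rewrite /mass measureU//.
    by rewrite fineD//; exact: fin_num_measure.
  have := mlim _ (cylinderU cA cB); rewrite E => mAB.
  exact: (cvg_unique (@Rhausdorff R) mAB (cvgD (mlim _ cA) (mlim _ cB))).
exists P; split => //; apply: weak_level_cvg => h a.
rewrite [X in _ --> X]/mass Pm; last exact: level_cylinder.
exact/mlim/level_cylinder.
Qed.

End WeakSpace.
(** * Measurability in countable products *)

Section CountableProduct.
Variables (R : realType) (I : countType).
Local Notation X := {ptws I -> R}.

Lemma ptws_hausdorff : hausdorff_space X.
Proof. by apply: (@hausdorff_product I (fun=> R)) => i; exact: Rhausdorff. Qed.

Variables (d : measure_display) (T : measurableType d) (Y : T -> X).
Hypothesis mY : forall i, measurable_fun [set: T] (fun w => Y w i).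

Lemma ptws_nbhs_measurable (x : X) (O : set X) : nbhs x O ->
  exists B : set X, [/\ open B, B x, B `<=` O & measurable (Y @^-1` B)].
Proof.
pose D : set (set X) := [set B | [/\ open B, B x & measurable (Y @^-1` B)]].
(* It suffices that the filter generated by the sets B converges to x.          *)
have FF : Filter (filter_from D id).
  apply: filter_from_filter.
    by exists setT; split; rewrite ?preimage_setT//; exact: openT.
  move=> A B [oA Ax mA] [oB Bx mB]; exists (A `&` B) => //.
  by split; [exact: openI|split|rewrite preimage_setI; exact: measurableI].
have /(_ O) H : filter_from D id --> x.
  apply/ptws_cvgP => i A /nbhs_ballP[e /= e0 eA].
  exists [set g : X | ball (x i) e (g i)]; last by move=> g; exact: eA.
  split; last 2 first.
  - exact: ballxx.
  - have := @mY i measurableT _ (measurable_ball (x i) e).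
    by rewrite setTI.
  - apply: (@open_comp X R (fun g : X => g i)); last exact: ball_open.
    by move=> g _; exact: (@proj_continuous I (fun=> R) i g).
by move=> /H[B [oB Bx mB] BO]; exists B.
Qed.

(** Only the coordinates of [Y] are known to be measurable. For each n, finitely many small open
    sets with measurable preimages cover [C]; as [C] is closed, it is the intersection of these
    covers. *)
Lemma compact_ptws_measurable (C : set X) :
  compact C -> measurable (Y @^-1` C).
Proof.
move=> coC; have clC : closed C by apply: compact_closed => //; exact: ptws_hausdorff.
pose pX : ptopologicalType := HB.pack X (isPointed.Build X (fun=> 0)).
have U n : exists U : set X, [/\ C `<=` U, measurable (Y @^-1` U) &
    forall y, U y -> exists2 x, C x & ball x n.+1%:R^-1 y].
  have /choice[B BP] : forall x : X, exists B : set X,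
      [/\ open B, B x, B `<=` ball x n.+1%:R^-1 & measurable (Y @^-1` B)].
    by move=> x; apply: ptws_nbhs_measurable; exact: nbhsx_ballx.
  have := coC; rewrite (@compact_cover pX) => /(_ X C B)[||D DC CD].
  - by move=> x _; have [] := BP x.
  - by move=> x Cx; exists x => //; have [] := BP x.
  exists (\bigcup_(i in [set` D]) B i); split => //.
    rewrite preimage_bigcup; apply: fin_bigcup_measurable => //.
    by move=> i _; have [] := BP i.
  move=> y [x xD Bxy]; exists x; first by have /set_mem := DC _ xD.
  by have [_ _ + _] := BP x; apply.
have {U} /choice[U UP] := U.
rewrite (_ : C = \bigcap_n U n).
  by rewrite preimage_bigcap; apply: bigcapT_measurable => n; have [] := UP n.
apply/seteqP; split=> [x Cx n _|y Uy]; first by have [+ _ _] := UP n; apply.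
apply: clC => A /nbhs_ballP[e /= e0 eA].
have [n ne] := ltr_add_invr e0; rewrite add0r in ne.
have [_ _ /(_ y (Uy n Logic.I))[x Cx xy]] := UP n.
by exists x; split => //; apply: eA; apply: ball_sym; exact: le_ball (ltW ne) _ xy.
Qed.

Lemma compact_ptws_measurable_comp (C : set X) (f : X -> R) :
  compact C -> (forall w, C (Y w)) -> continuous f ->
  measurable_fun [set: T] (f \o Y).
Proof.
move=> coC CY cf.
apply: (measurability _ (RGenCInfty.measurableE R)) => _ [_ [a ->] <-].
rewrite setTI (_ : _ @^-1` _ = Y @^-1` (C `&` f @^-1` `[a, +oo[)).
  apply: compact_ptws_measurable; apply: compact_closedI => //.
  by apply: preimage_closed => //; exact: interval_closed.
by apply/seteqP; split=> w //= [].
Qed.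

End CountableProduct.
(** * Pattern masses and their limits *)

Lemma window_pat_cylinder k (p : 'S_k.+1) c :
  (c <= k)%N -> cylinder (window_pat p c).
Proof.
move=> ck; exists k => x y xy xp a b; rewrite -(xp a b).
have wd (u : 'I_k.+1) : - k%:Z <= u%:Z - c%:Z <= k%:Z by have := ltn_ord u; lia.
have lt (u : 'I_k.+1) : (absz (u%:Z - c%:Z + k%:Z)%R < k.*2.+1)%N.
  by have := wd u; lia.
rewrite -(codeE y (lt a) (lt b) (wd a) (wd b)).
by rewrite -(codeE x (lt a) (lt b) (wd a) (wd b)) xy.
Qed.

Section LimitSet.
Variable R : realType.
Local Notation S := (rooted_space R).
Local Notation W := (weak_probability R S).

Lemma mass_rooted_law n (s : 'S_n.+1) (A : set S) : cylinder A ->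
  mass A (rooted_law R s) =
  #|[set i : 'I_n.+1 | `[< A (rooted s i) >] ]%SET|%:R / n.+1%:R.
Proof.
move=> cA; rewrite /mass /rooted_law /= /distribution /pushforward.
rewrite /uniform_index /mscale /= /msum.
rewrite /dirac sumEFin -EFinM /= mulrC; congr (_ / _).
rewrite -sum1_card natr_sum [RHS]big_mkcond /=; apply: eq_bigr => i _.
rewrite indicE inE inord_val; have [Ai|nAi] := pselect (A (rooted s i)).
  by rewrite asboolT// mem_set.
by rewrite asboolF// memNset.
Qed.

Definition pattern_mass (mu : W) : {ptws pattern -> R} :=
  fun p => mass (window_pat (tagged p) 0) mu.

Lemma pattern_mass_rooted_law n (s : 'S_n.+1) (p : pattern) :
  pattern_mass (rooted_law R s) p = prop_c_occ R p s.
Proof.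
case: p => k p; rewrite /pattern_mass mass_rooted_law; last exact: window_pat_cylinder.
by rewrite card_window_pat.
Qed.

Lemma pattern_mass_continuous : continuous pattern_mass.
Proof.
move=> mu; have FF : Filter (pattern_mass @ nbhs mu) by exact: fmap_filter.
apply/ptws_cvgP => -[k p].
exact: (mass_continuous (window_pat_cylinder p (leq0n k))).
Qed.

Lemma pattern_mass_ge0 mu p : 0 <= pattern_mass mu p.
Proof. exact: mass_ge0. Qed.

Lemma pattern_mass_le1 mu p : pattern_mass mu p <= 1.
Proof. by apply: mass_le1; exact: window_pat_cylinder. Qed.

(* For a measure which is invariant under re-rooting and gives no mass to roots *)
(* at finite distance from the boundary, the mass of level e is the mass of the *)
(* pattern with code e if there is one, and 0 otherwise.                        *)
Definition code_mass h (e : {ffun 'I_h.*2.+1 * 'I_h.*2.+1 -> bool})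
    (x : pattern -> R) : R :=
  if [pick p | @pat_code h p == e] is Some p
  then x (existT (fun k => 'S_k.+1) h.*2 p) else 0.

Definition defect h e (mu : W) : R :=
  mass (@level h e) mu - code_mass e (pattern_mass mu).

Lemma code_mass_cvg (T : Type) (F : set_system T) h e (x : T -> pattern -> R)
    (y : pattern -> R) : Filter F ->
  (forall p, x t p @[t --> F] --> y p) ->
  @code_mass h e (x t) @[t --> F] --> code_mass e y.
Proof.
move=> FF xy; rewrite /code_mass; case: pickP => [p _|_]; first exact: xy.
exact: cvg_cst.
Qed.

Lemma defect_continuous h e : continuous (@defect h e).
Proof.
move=> mu; have cm : @code_mass h e (pattern_mass nu) @[nu --> mu] -->
    code_mass e (pattern_mass mu).
  apply: (@code_mass_cvg _ (nbhs mu)) => -[k p].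
  exact: (mass_continuous (window_pat_cylinder p (leq0n k))).
apply: cvgB; [exact: (nbhs_filter (mu : W))| |exact: cm].
exact: (mass_continuous (level_cylinder e)).
Qed.

(** If [e] is the code of a pattern, the defect is 0: the root is at entry h in the level and at
    entry 0 in [pattern_mass], with equal counts. Otherwise only roots near the boundary
    contribute. *)
Lemma defect_rooted_law h e n (s : 'S_n.+1) :
  `|@defect h e (rooted_law R s)| <= h.*2%:R / n.+1%:R.
Proof.
rewrite /defect /code_mass; case: pickP => [p /eqP <-|ep].
  rewrite pattern_mass_rooted_law level_pat_code mass_rooted_law; last first.
    by apply: window_pat_cylinder; rewrite -addnn leq_addr.
  rewrite card_window_pat; last by rewrite -addnn leq_addr.
  by rewrite subrr normr0.
rewrite subr0 ger0_norm ?mass_ge0// mass_rooted_law; last exact: level_cylinder.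
rewrite ler_pM2r ?invr_gt0// ler_nat.
have /(card_level_boundary s) : forall p, pat_code p <> e.
  by move=> p /eqP; rewrite ep.
apply: leq_trans; apply: subset_leq_card; apply/fintype.subsetP => i.
by rewrite !inE => /eqP.
Qed.

Definition limit_set : set W := [set mu | forall h e, @defect h e mu = 0].

Lemma limit_set_closed : closed limit_set.
Proof.
rewrite (_ : limit_set = \bigcap_h \bigcap_e (@defect h e @^-1` [set 0])).
  apply: closed_bigI => h _; apply: closed_bigI => e _.
  by apply: preimage_closed; [move=> ? _; exact: defect_continuous|exact: closed_eq].
by apply/seteqP; split=> mu Zmu h; [move=> _ e _; exact: Zmu|move=> e; exact: Zmu].
Qed.

Lemma limit_set_compact : compact limit_set.
Proof.
exact: subclosed_compact limit_set_closed (@weak_probability_compact R) _.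
Qed.

(** On the limit set, pattern masses determine all level masses, so the principal filter at [mu]
    converges to [nu]. Topological indistinguishability replaces equality of measures; closed sets
    and continuous functions see no more. *)
Lemma limit_set_indistinguishable (mu nu : W) (C : set W) :
  limit_set mu -> limit_set nu -> pattern_mass mu = pattern_mass nu ->
  closed C -> C mu -> C nu.
Proof.
move=> Zmu Znu mn clC Cmu; apply: clC => A.
have : globally [set mu] --> nu.
  apply: weak_level_cvg => h e; apply: cvg_near_cst => _ ->.
  have := Zmu h e; have := Znu h e; rewrite /defect mn.
  by move=> /subr0_eq -> /subr0_eq.
by move=> /[apply] Amu; exists mu; split => //; exact: Amu.
Qed.

(** Otherwise laws of arbitrarily large permutations with [|f| >= e] would have a cluster point. Its
    defects vanish, so it lies in the limit set, where [f] is 0, against continuity. *)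
Lemma vanish_limit_set (f : W -> R) (e : R) : continuous f -> 0 < e ->
  (forall mu, limit_set mu -> f mu = 0) ->
  exists N, forall n (s : 'S_n.+1), (N <= n)%N -> `|f (rooted_law R s)| < e.
Proof.
move=> cf e0 fZ; apply: contrapT => nN.
pose D N : set W := [set mu | exists n (s : 'S_n.+1),
  [/\ (N <= n)%N, mu = rooted_law R s & e <= `|f mu|]].
have Dex N : D N !=set0.
  apply: contrapT => nD; apply: nN; exists N => n s Nn; rewrite ltNge.
  by apply/negP => ef; apply: nD; exists (rooted_law R s), n, s.
have FF : ProperFilter (filter_from setT D).
  apply: filter_from_proper => //; apply: filter_from_filter; first by exists 0%N.
  move=> i j _ _; exists (maxn i j) => // mu [n [s [+ mus ef]]].
  by rewrite geq_max => /andP[? ?]; split; exists n, s.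
have [mu [_ clmu]] := @weak_probability_compact R _ FF filterT.
have muD (g : W -> R) (r : R) N : continuous g -> 0 < r ->
    exists n (s : 'S_n.+1), [/\ (N <= n)%N, e <= `|f (rooted_law R s)| &
      `|g mu - g (rooted_law R s)| < r].
  move=> cg r0; have /cvgrPdist_lt/(_ _ r0) gr := cg mu.
  have DF : filter_from setT D (D N) by exists N.
  have [nu [[n [s [Nn nuE ef]]] gnu]] := clmu _ _ DF gr.
  by exists n, s; rewrite -nuE.
have Zmu : limit_set mu.
  move=> h a; apply/eqP; rewrite -normr_le0; apply/ler_addgt0Pl => r r0.
  rewrite addr0; have r2 : 0 < r / 2 by rewrite divr_gt0.
  have [N Nr] : exists N : nat, h.*2%:R / (r / 2) < N%:R :> R.
    by exists (Num.truncn (h.*2%:R / (r / 2)) ).+1; exact: truncnS_gt.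
  have [n [s [Nn _ gs]]] := muD _ _ N (@defect_continuous h a) r2.
  have := defect_rooted_law a s.
  have : h.*2%:R / n.+1%:R <= r / 2.
    rewrite ler_pdivrMr// mulrC -ler_pdivrMr// ltW// (lt_le_trans Nr)// ler_nat.
    exact: leqW.
  move=> hr /le_trans/(_ hr) dr.
  rewrite -(subrK (defect a (rooted_law R s)) (defect a mu)).
  by rewrite (le_trans (ler_normD _ _))// [r]splitr lerD// ltW.
have [n [s [_ ef fs]]] := muD _ _ 0%N cf e0.
by move: fs; rewrite fZ// sub0r normrN ltNge ef.
Qed.

End LimitSet.
(** * Annealed convergence *)

Section Expectation.
Variable R : realType.

Lemma expectation_Rintegral d (T : measurableType d) (P : probability T R)
    (f : T -> R) : measurable_fun [set: T] f -> bounded_fun f ->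
  'E_P[f]%E = ((\int[P]_x f x)%R)%:E.
Proof.
move=> mf bf; rewrite unlock /Rintegral fineK//.
by apply: integrable_fin_num => //; exact: bounded_integrable.
Qed.

Lemma cvg_EFinP (u : nat -> R) (l : R) :
  ((u n)%:E @[n --> \oo] --> l%:E)%E <-> u @ \oo --> l.
Proof.
split=> [/fine_cvg //|ul]; apply: cvg_EFin => //.
by apply: nearW.
Qed.

Lemma expectation_close_cvg (d : nat -> measure_display)
    (T : forall n, measurableType (d n)) (P : forall n, probability (T n) R)
    (f g : forall n, T n -> R) (l : R) :
  (forall n, measurable_fun [set: T n] (f n)) -> (forall n, bounded_fun (f n)) ->
  (forall n, measurable_fun [set: T n] (g n)) -> (forall n, bounded_fun (g n)) ->
  (forall e, 0 < e -> exists N, forall n, (N <= n)%N ->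
    forall w, `|f n w - g n w| <= e) ->
  ('E_(P n)[f n] @[n --> \oo] --> l%:E)%E ->
  ('E_(P n)[g n] @[n --> \oo] --> l%:E)%E.
Proof.
move=> mf bf mg bg fg.
under eq_cvg do rewrite expectation_Rintegral//.
under [X in _ -> X]eq_cvg do rewrite expectation_Rintegral//.
move=> /cvg_EFinP fl; apply/cvg_EFinP; apply/cvgrPdist_lt => e e0.
have e2 : 0 < e / 2 by rewrite divr_gt0.
have [N Nfg] := fg _ e2.
move/cvgrPdist_lt/(_ _ e2) : fl; apply: filter_app; exists N => // n /= Nn fle.
rewrite (le_lt_trans (ler_distD (\int[P n]_x f n x)%R _ _))// [e]splitr.
by rewrite ltr_leD//; apply: Rintegral_close => //; exact: Nfg.
Qed.

Lemma expectation_distribution d (T : measurableType d) (P : probability T R)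
    (X : {RV P >-> borel (rooted_space R)}) (f : rooted_space R -> R) :
  continuous f -> bounded_fun f ->
  'E_P[f \o X]%E = ((\int[distribution P X]_x f x)%R)%:E.
Proof.
move=> cf bf.
have mf : measurable_fun [set: borel (rooted_space R)] (f : borel _ -> R).
  exact: continuous_borel_measurable.
have mfX : measurable_fun [set: T] (f \o X).
  exact: measurableT_comp mf (measurable_funPT X).
have bfX : bounded_fun (f \o X).
  by have /bounded_fun_leP[M fM] := bf; apply/bounded_fun_leP; exists M => w; exact: fM.
rewrite expectation_Rintegral// /Rintegral integral_distribution//.
  exact/measurable_EFinP.
exact: bounded_integrable.
Qed.

End Expectation.

Section RandomPermutation.
Variables (R : realType) (d : nat -> measure_display).
Variables (T : forall n, measurableType (d n)).
Variables (P : forall n, probability (T n) R).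
Variables (sigma : forall n, {RV (P n) >-> 'S_n.+1}).
Local Notation S := (rooted_space R).
Local Notation W := (weak_probability R S).

Lemma perm_fun_measurable n (g : 'S_n.+1 -> R) :
  measurable_fun [set: T n] (fun w => g (sigma n w)).
Proof.
have mg : measurable_fun [set: 'S_n.+1] g by [].
exact: measurableT_comp mg (measurable_funPT (sigma n)).
Qed.

Lemma perm_fun_bounded n (g : 'S_n.+1 -> R) :
  bounded_fun (fun w : T n => g (sigma n w)).
Proof.
apply/bounded_fun_leP; exists (\sum_s `|g s|) => w.
by rewrite (bigD1 (sigma n w))//= lerDl sumr_ge0.
Qed.

Definition annealed_fun n (w : T n * 'I_n.+1) : borel S :=
  rooted (sigma n w.1) w.2.

Lemma annealed_fun_measurable n :
  measurable_fun [set: T n * 'I_n.+1] (@annealed_fun n).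
Proof.
have mg : measurable_fun [set: 'S_n.+1 * 'I_n.+1]
    (fun u => rooted u.1 u.2 : borel S).
  move=> _ A mA; rewrite setTI.
  rewrite (_ : _ @^-1` _ = \bigcup_(u in [set u | A (rooted u.1 u.2)])
      ([set u.1] `*` [set u.2])); last first.
    apply/seteqP; split=> [u Au|u [v Av [/= uv1 uv2]]]; first by exists u.
    by rewrite /preimage /= uv1 uv2.
  apply: fin_bigcup_measurable; first exact: finite_finset.
  by move=> u _; apply: measurableX.
have mh : measurable_fun [set: T n * 'I_n.+1] (fun w => (sigma n w.1, w.2)).
  apply: measurable_fun_pair => //.
  exact: measurableT_comp (measurable_funPT (sigma n)) measurable_fst.
exact: measurableT_comp mg mh.
Qed.

HB.instance Definition _ n :=
  isMeasurableFun.Build _ _ _ _ (@annealed_fun n) (@annealed_fun_measurable n).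

Definition annealed_law n : W :=
  distribution (P n \x @uniform_index R n)%E (@annealed_fun n).

(** The product measure integrates the masses of sections, and the section at [w] is the event under
    the rooted law of [sigma n w]. *)
Lemma mass_annealed_law n (A : set S) : cylinder A ->
  mass A (annealed_law n) = (\int[P n]_w mass A (rooted_law R (sigma n w)))%R.
Proof.
move=> cA; rewrite /mass /annealed_law /= /distribution /pushforward /=.
rewrite /product_measure1 /Rintegral; congr fine; apply: eq_integral => w _ /=.
have Afin := fin_num_measure (rooted_law R (sigma n w) : probability (borel S) R)
  _ (cylinder_measurable cA).
rewrite (fineK Afin).
rewrite /rooted_law /distribution /pushforward; congr (uniform_index R _).
by apply/seteqP; split=> i; rewrite /xsection /= ?inE.
Qed.

Lemma annealed_pattern_mass n (p : pattern) :
  'E_(P n)[fun w => prop_c_occ R p (sigma n w)]%E =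
  (pattern_mass (annealed_law n) p)%:E.
Proof.
rewrite expectation_Rintegral; last 2 first.
- exact: perm_fun_measurable.
- exact: perm_fun_bounded.
rewrite /pattern_mass mass_annealed_law; last exact: window_pat_cylinder.
congr (_%:E); apply: eq_Rintegral => w _.
exact: (esym (pattern_mass_rooted_law R (sigma n w) p)).
Qed.

Lemma annealed_level_cvg (Delta : pattern -> R) h e :
  (forall p, pattern_mass (annealed_law n) p @[n --> \oo] --> Delta p) ->
  mass (@level h e) (annealed_law n) @[n --> \oo] --> code_mass e Delta.
Proof.
move=> cvgD; have /cvgrPdist_lt cm :
    code_mass e (pattern_mass (annealed_law n)) @[n --> \oo] --> code_mass e Delta.
  exact: code_mass_cvg.
apply/cvgrPdist_lt => r r0; have r2 : 0 < r / 2 by rewrite divr_gt0.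
have [N Nr] : exists N : nat, h.*2%:R / (r / 2) < N%:R :> R.
  by exists (Num.truncn (h.*2%:R / (r / 2)) ).+1; exact: truncnS_gt.
move: (cm _ r2); apply: filter_app; exists N => // n /= Nn cmn.
rewrite (le_lt_trans (ler_distD (code_mass e (pattern_mass (annealed_law n))) _ _))//.
rewrite [r]splitr ltr_leD//.
have -> : code_mass e (pattern_mass (annealed_law n)) =
    (\int[P n]_w (code_mass e (pattern_mass (rooted_law R (sigma n w)))))%R.
  rewrite /code_mass; case: pickP => [p _|_].
    by rewrite /pattern_mass mass_annealed_law//; exact: window_pat_cylinder.
  by rewrite Rintegral_cst// mul0r.
rewrite mass_annealed_law; last exact: level_cylinder.
apply: Rintegral_close.
- exact: (perm_fun_measurable (fun s => code_mass e (pattern_mass (rooted_law R s)))).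
- exact: (perm_fun_bounded (fun s => code_mass e (pattern_mass (rooted_law R s)))).
- exact: (perm_fun_measurable (fun s => mass (level e) (rooted_law R s))).
- exact: (perm_fun_bounded (fun s => mass (level e) (rooted_law R s))).
move=> w; rewrite distrC (le_trans (defect_rooted_law R e (sigma n w)))//.
rewrite ler_pdivrMr// mulrC -ler_pdivrMr// ltW// (lt_le_trans Nr)// ler_nat.
exact: leqW.
Qed.

Lemma annealed_cvg_pattern : annealed_BS_cvg sigma ->
  exists Delta : pattern -> R, (forall p, 0 <= Delta p) /\
    forall p, ('E_(P n)[fun w => prop_c_occ R p (sigma n w)] @[n --> \oo]
      --> (Delta p)%:E)%E.
Proof.
move=> [d' [T' [Q [X QX]]]]; exists (pattern_mass (distribution Q X)); split.
  by move=> p; exact: pattern_mass_ge0.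
move=> p; have cA : cylinder (window_pat (tagged p) 0) by exact: window_pat_cylinder.
have := QX (\1_(window_pat (tagged p) 0)) (cylinder_indic_continuous cA)
  (@bounded_fun_indic R _ _).
rewrite expectation_distribution//; last 2 first.
- exact: cylinder_indic_continuous.
- exact: bounded_fun_indic.
rewrite Rintegral_indicE//.
apply: cvg_trans; apply: near_eq_cvg; apply: nearW => n.
rewrite annealed_pattern_mass (@expectation_distribution _ _ _ _ (@annealed_fun n)).
- by rewrite Rintegral_indicE.
- exact: cylinder_indic_continuous.
- exact: bounded_fun_indic.
Qed.

Lemma pattern_cvg_annealed (Delta : pattern -> R) :
  (forall p, ('E_(P n)[fun w => prop_c_occ R p (sigma n w)] @[n --> \oo]
    --> (Delta p)%:E)%E) ->
  annealed_BS_cvg sigma.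
Proof.
move=> cvgD.
have {}cvgD p : pattern_mass (annealed_law n) p @[n --> \oo] --> Delta p.
  apply/cvg_EFinP; have := cvgD p.
  by under eq_cvg do rewrite annealed_pattern_mass.
have [nu [_ clnu]] := @weak_probability_compact R (annealed_law @ \oo) _ filterT.
have nu_level h e : mass (@level h e) nu = code_mass e Delta.
  have /cvgrPdist_lt lD := annealed_level_cvg (e := e) cvgD.
  have /cvgrPdist_lt ln := mass_continuous (level_cylinder e) (x := nu).
  apply/eqP; rewrite -subr_eq0 -normr_le0; apply/ler_addgt0Pl => r r0.
  rewrite addr0; have r2 : 0 < r / 2 by rewrite divr_gt0.
  have [mu [/= muD mun]] :=
    clnu [set mu | `|code_mass e Delta - mass (level e) mu| < r / 2]
      _ (lD _ r2) (ln _ r2).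
  rewrite (le_trans (ler_distD (mass (level e) mu) _ _))// [r]splitr lerD// ltW//.
  by rewrite distrC.
have cvgnu : annealed_law @ \oo --> nu.
  by apply: weak_level_cvg => h e; rewrite nu_level; exact: annealed_level_cvg.
(* The limit variable is the identity on the space of rooted permutations with law [nu]. *)
have mid : measurable_fun [set: borel S] (id : borel S -> borel S) by [].
pose Q : probability (borel S) R := nu.
pose X : {RV Q >-> borel S} :=
  HB.pack (id : borel S -> borel S) (isMeasurableFun.Build _ _ _ _ _ mid).
exists _, (borel S), Q, X => f cf bf.
have -> : 'E_Q[f \o X]%E = (weak_eval nu (exist _ f (conj cf bf)))%:E.
  rewrite expectation_Rintegral//; last exact: continuous_borel_measurable.
rewrite (_ : (fun n => _) =
    fun n => (weak_eval (annealed_law n) (exist _ f (conj cf bf)))%:E).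
  by apply/cvg_EFinP; move/weak_cvgP : cvgnu; apply.
apply/funext => n.
by rewrite (@expectation_distribution _ _ _ _ (@annealed_fun n)).
Qed.

End RandomPermutation.
(** * Quenched convergence *)

(* This makes {ptws pattern -> R} a pseudometric space, hence a normal one.     *)
HB.instance Definition _ := Countable.copy pattern {k : nat & 'S_k.+1}.

Section Quenched.
Variables (R : realType) (d : nat -> measure_display).
Variables (T : forall n, measurableType (d n)).
Variables (P : forall n, probability (T n) R).
Variables (sigma : forall n, {RV (P n) >-> 'S_n.+1}).
Local Notation S := (rooted_space R).
Local Notation W := (weak_probability R S).
Local Notation X := {ptws pattern -> R}.
Local Notation occ n w := (fun p : pattern => prop_c_occ R p (sigma n w)).

Lemma pattern_mass_rooted_lawE n (s : 'S_n.+1) :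
  pattern_mass (rooted_law R s) = fun p : pattern => prop_c_occ R p s.
Proof. by apply/funext => p; exact: pattern_mass_rooted_law. Qed.

Lemma pattern_mass1_continuous p : continuous (fun mu : W => pattern_mass mu p).
Proof. exact: mass_continuous (window_pat_cylinder (tagged p) (leq0n _)). Qed.

Lemma quenched_cvg_pattern : quenched_BS_cvg sigma ->
  exists (d' : measure_display) (T' : measurableType d')
      (Q : probability T' R) (Lambda : pattern -> {RV Q >-> R}),
    (forall (p : pattern) (w : T'), 0 <= Lambda p w) /\
    cvg_in_distribution (S := {ptws pattern -> R}) P
      (fun (n : nat) (w : T n) (p : pattern) => prop_c_occ R p (sigma n w))
      Q (fun (w : T') (p : pattern) => Lambda p w).
Proof.
move=> [d' [T' [Q [M QM]]]].
have mL p : measurable_fun [set: T'] (fun w => pattern_mass (M w) p).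
  apply: (measurableT_comp _ (measurable_funPT M)).
  exact: (continuous_borel_measurable (pattern_mass1_continuous (p := p))).
pose Lambda p : {RV Q >-> R} :=
  HB.pack (fun w => pattern_mass (M w) p) (isMeasurableFun.Build _ _ _ _ _ (mL p)).
exists d', T', Q, Lambda; split; first by move=> p w; exact: pattern_mass_ge0.
move=> f cf bf.
have cfp : continuous (f \o (@pattern_mass R)).
  by move=> mu; apply: continuous_comp; [exact: pattern_mass_continuous|exact: cf].
have bfp : bounded_fun (f \o (@pattern_mass R)).
  by have /bounded_fun_leP[B fB] := bf; apply/bounded_fun_leP; exists B => mu; exact: fB.
apply: cvg_trans (QM _ cfp bfp); apply: near_eq_cvg; apply: nearW => n.
congr expectation; apply/funext => w /=.
by rewrite pattern_mass_rooted_lawE.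
Qed.

Lemma quenched_annealed : quenched_BS_cvg sigma -> annealed_BS_cvg sigma.
Proof.
move=> [d' [T' [Q [M QM]]]].
apply: (@pattern_cvg_annealed _ _ _ _ _
  (fun p => (\int[Q]_w pattern_mass (M w) p)%R)) => p.
have cp := pattern_mass1_continuous (p := p).
have bp : bounded_fun (fun mu : W => pattern_mass mu p).
  apply/bounded_fun_leP; exists 1 => mu.
  by rewrite ger0_norm ?pattern_mass_le1 ?pattern_mass_ge0.
rewrite -expectation_Rintegral; last 2 first.
- apply: (measurableT_comp _ (measurable_funPT M)).
  exact: (continuous_borel_measurable cp).
- by have /bounded_fun_leP[B fB] := bp; apply/bounded_fun_leP; exists B => w; exact: fB.
apply: cvg_trans (QM _ cp bp); apply: near_eq_cvg; apply: nearW => n.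
congr expectation; apply/funext => w /=.
exact: pattern_mass_rooted_law.
Qed.

Definition clamp (x : X) : X := fun p => Num.max 0 (Num.min 1 (x p)).

Definition cube : set X := [set x | forall p, `[0, 1]%classic (x p)].

Lemma clamp_cube x : cube (clamp x).
Proof.
move=> p; rewrite /= in_itv /= /clamp le_max lexx /=.
by rewrite ge_max ler01 ge_min lexx.
Qed.

Lemma clamp_id x : cube x -> clamp x = x.
Proof.
move=> cx; apply/funext => p; have := cx p; rewrite /= in_itv /= => /andP[x0 x1].
by rewrite /clamp (min_idPr x1) (max_idPr x0).
Qed.

Lemma clamp_continuous : continuous clamp.
Proof.
move=> x; have FF : Filter (clamp @ nbhs x) by exact: fmap_filter.
apply/ptws_cvgP => p.
have cr (r : R) : Num.max 0 (Num.min 1 u) @[u --> r] --> Num.max 0 (Num.min 1 r).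
  apply: (@continuous_max R R (cst 0) (cst 1 \min id)); first exact: cst_continuous.
  by apply: continuous_min; [exact: cst_continuous|exact: cvg_id].
exact: (cvg_comp _ _ (@proj_continuous pattern (fun=> R) p x) (cr (x p))).
Qed.

Lemma cube_compact : compact cube.
Proof.
exact: (@tychonoff pattern (fun=> R) (fun=> `[0, 1]%classic)
  (fun=> @segment_compact R 0 1)).
Qed.

Definition limit_pattern : set X := (@pattern_mass R) @` (@limit_set R).

Lemma pattern_mass_compact (C : set W) : closed C ->
  compact ((@pattern_mass R) @` (C `&` @limit_set R)).
Proof.
move=> clC; apply: continuous_compact.
  by apply: continuous_subspaceT; exact: pattern_mass_continuous.
by rewrite setIC; apply: compact_closedI => //; exact: limit_set_compact.
Qed.

Lemma limit_pattern_compact : compact limit_pattern.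
Proof. by have := @pattern_mass_compact setT closedT; rewrite setTI. Qed.

Lemma limit_pattern_closed : closed limit_pattern.
Proof.
apply: compact_closed; last exact: limit_pattern_compact.
exact: (@ptws_hausdorff R pattern).
Qed.

Variables (d' : measure_display) (T' : measurableType d').
Variables (Q : probability T' R) (Lambda : pattern -> {RV Q >-> R}).
Hypothesis Lambda_cvg : cvg_in_distribution (S := X) P
  (fun (n : nat) (w : T n) (p : pattern) => prop_c_occ R p (sigma n w))
  Q (fun (w : T') (p : pattern) => Lambda p w).

(* Replacing Lambda by its truncation makes all values lie in a compact cube,   *)
(* where closed sets are compact and hence measurable by                        *)
(* compact_ptws_measurable; the frequencies prop_c_occ are unaffected.          *)
Definition clamped (w : T') : X := clamp (fun p => Lambda p w).

Lemma clamped_measurable p : measurable_fun [set: T'] (fun w => clamped w p).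
Proof.
exact: (@measurable_maxr _ _ _ _ (cst 0) (cst 1 \min Lambda p)).
Qed.

Lemma clamped_cvg (f : X -> R) : continuous f -> bounded_fun f ->
  ('E_(P n)[fun w => f (occ n w)] @[n --> \oo] --> 'E_Q[f \o clamped])%E.
Proof.
move=> cf bf.
have cfc : continuous (f \o clamp).
  by move=> x; apply: continuous_comp; [exact: clamp_continuous|exact: cf].
have bfc : bounded_fun (f \o clamp).
  by have /bounded_fun_leP[B fB] := bf; apply/bounded_fun_leP; exists B => x; exact: fB.
apply: cvg_trans (Lambda_cvg cfc bfc); apply: near_eq_cvg; apply: nearW => n.
congr expectation; apply/funext => w /=; rewrite clamp_id// => p.
rewrite -pattern_mass_rooted_law /= in_itv /=.
by rewrite pattern_mass_ge0 pattern_mass_le1.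
Qed.

Lemma comp_clamped_measurable (f : X -> R) : continuous f ->
  measurable_fun [set: T'] (f \o clamped).
Proof.
move=> cf; apply: (compact_ptws_measurable_comp _ cube_compact) => //.
  exact: clamped_measurable.
by move=> w; exact: clamp_cube.
Qed.

Lemma preimage_clamped_measurable (C : set X) :
  closed C -> measurable (clamped @^-1` C).
Proof.
move=> clC; rewrite (_ : _ @^-1` _ = clamped @^-1` (cube `&` C)).
  apply: compact_ptws_measurable; first exact: clamped_measurable.
  by apply: compact_closedI => //; exact: cube_compact.
by apply/seteqP; split=> w /= => [?|[]//]; split=> //; exact: clamp_cube.
Qed.

End Quenched.

(** * Lifting the limit vector to a random measure *)

Section QuenchedLimit.
Variables (R : realType) (d : nat -> measure_display).
Variables (T : forall n, measurableType (d n)).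
Variables (P : forall n, probability (T n) R).
Variables (sigma : forall n, {RV (P n) >-> 'S_n.+1}).
Local Notation S := (rooted_space R).
Local Notation W := (weak_probability R S).
Local Notation X := {ptws pattern -> R}.
Variables (d' : measure_display) (T' : measurableType d').
Variables (Q : probability T' R) (Lambda : pattern -> {RV Q >-> R}).
Hypothesis Lambda_cvg : cvg_in_distribution (S := X) P
  (fun (n : nat) (w : T n) (p : pattern) => prop_c_occ R p (sigma n w))
  Q (fun (w : T') (p : pattern) => Lambda p w).

Local Notation Y := (clamped Lambda).
Local Notation K := (@limit_pattern R).

(** The difference of [f] and [G] composed with [pattern_mass] vanishes on the limit set, hence is
    uniformly small on laws of large permutations. *)
Lemma clamped_expectation_cvg (f : W -> R) (G : X -> R) :
  continuous f -> bounded_fun f -> continuous G -> bounded_fun G ->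
  (forall mu, limit_set mu -> f mu = G (pattern_mass mu)) ->
  ('E_(P n)[fun w => f (rooted_law R (sigma n w))] @[n --> \oo]
    --> 'E_Q[G \o Y])%E.
Proof.
move=> cf bf cG bG fG; have := clamped_cvg Lambda_cvg cG bG.
rewrite expectation_Rintegral; last 2 first.
- exact: comp_clamped_measurable.
- by have /bounded_fun_leP[B GB] := bG; apply/bounded_fun_leP; exists B => w; exact: GB.
apply: expectation_close_cvg => [n|n|n|n|e e0].
- exact: (perm_fun_measurable _ (fun s => G (fun p => prop_c_occ R p s))).
- exact: (perm_fun_bounded _ (fun s => G (fun p => prop_c_occ R p s))).
- exact: (perm_fun_measurable _ (fun s => f (rooted_law R s))).
- exact: (perm_fun_bounded _ (fun s => f (rooted_law R s))).
have cGf : continuous (fun mu : W => G (pattern_mass mu) - f mu).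
  move=> mu; apply: cvgB; [exact: (nbhs_filter (mu : W))| |exact: cf].
  exact: (cvg_comp _ _ (@pattern_mass_continuous R mu) (cG (pattern_mass mu))).
have [|N NGf] := vanish_limit_set cGf e0.
  by move=> mu Zmu; rewrite fG// subrr.
exists N => n Nn w; rewrite -pattern_mass_rooted_lawE ltW//.
exact: NGf.
Qed.

(** A Urysohn function [G], 0 on [K] and 1 on [C], agrees over the limit set with the zero function.
    So the expectation of [G] at the limit vector is 0, and it dominates the probability of [C]. *)
Lemma clamped_separated (C : set X) : closed C -> K `&` C = set0 ->
  Q (Y @^-1` C) = 0%E.
Proof.
move=> clC KC.
have nX : normal_space X by exact: (@pseudometric_normal R X).
have clK := @limit_pattern_closed R.
have [G [cG GK GC G01]] := @urysohn_ext_itv X R nX K C 0 1 clK clC KC ltr01.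
have {}G01 x : 0 <= G x <= 1.
  by have := G01 (G x) (ex_intro2 _ _ x Logic.I erefl); rewrite /= in_itv.
have bG : bounded_fun G.
  apply/bounded_fun_leP; exists 1 => x; have /andP[G0 G1] := G01 x.
  by rewrite ger0_norm.
have b0 : bounded_fun (cst 0 : W -> R).
  by apply/bounded_fun_leP; exists 0 => mu; rewrite normr0.
have GZ (mu : W) : limit_set mu -> cst 0 mu = G (pattern_mass mu).
  by move=> Zmu; symmetry; apply: GK; exists (pattern_mass mu) => //; exists mu.
have := clamped_expectation_cvg (@cst_continuous _ _ 0) b0 cG bG GZ.
rewrite (_ : (fun n => _) = fun=> 0%E); last first.
  by apply/funext => n; rewrite -[RHS](expectation_cst (P n) 0).
move=> /(cvg_unique (@ereal_hausdorff R) (cvg_cst _)) G0.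
have mYC := preimage_clamped_measurable Lambda clC.
apply/eqP; rewrite eq_le measure_ge0 andbT [leRHS]G0 -(expectation_indic Q mYC).
apply: expectation_le => //.
- exact: comp_clamped_measurable.
- by move=> w; have /andP[] := G01 (Y w).
apply: aeW => w /=; rewrite indicE; case: (boolP (w \in _)) => [|_].
  by rewrite inE => wC; rewrite (GC (G (Y w))) //; exists (Y w).
by have /andP[] := G01 (Y w).
Qed.

Lemma clamped_limit_pattern : Q.-negligible (Y @^-1` (~` K)).
Proof.
(* Since [K] is closed, its complement is a countable union of closed sets disjoint from [K]. *)
pose C n : set X := ~` \bigcup_(x in K) (ball x n.+1%:R^-1)^°.
have clC n : closed (C n).
  by apply: open_closedC; apply: bigcup_open => x _; exact: open_interior.
have clK := @limit_pattern_closed R.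
have -> : ~` K = \bigcup_n C n.
  apply/seteqP; split=> [y nKy|y [n _ Cy] Ky]; last first.
    by apply: Cy; exists y => //; exact: nbhsx_ballx.
  apply: contrapT => nC; apply: nKy; apply: clK => A /nbhs_ballP[e /= e0 eA].
  have [n ne] := ltr_add_invr e0; rewrite add0r in ne.
  have /contrapT[x Kx /interior_subset xy] : ~ C n y by move=> Cy; apply: nC; exists n.
  by exists x; split => //; apply: eA; apply: ball_sym; exact: le_ball (ltW ne) _ xy.
rewrite preimage_bigcup; apply: negligible_bigcup => n; apply/negligibleP.
  exact: preimage_clamped_measurable.
apply: clamped_separated => //; rewrite -subset0 => x [Kx]; apply.
by exists x => //; exact: nbhsx_ballx.
Qed.

(* The default point of W outside K, which has probability 0.                   *)
Definition measure_of_pattern (x : X) : W :=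
  xget point [set mu | limit_set mu /\ pattern_mass mu = x].

Lemma measure_of_patternP x : K x -> limit_set (measure_of_pattern x) /\ pattern_mass (measure_of_pattern x) = x.
Proof.
by move=> [mu Zmu <-]; apply: (@xgetI _ _ [set nu | limit_set nu /\ _] mu).
Qed.

(** By indistinguishability the chosen preimage lies in [C] as soon as some preimage in the limit
    set does. The right-hand side is compact, which yields both measurability of the lift and its
    continuity on [K]. *)
Lemma preimage_measure_of_pattern (C : set W) : closed C ->
  K `&` measure_of_pattern @^-1` C = (@pattern_mass R) @` (C `&` @limit_set R).
Proof.
move=> clC; apply/seteqP; split=> [x [Kx Cx]|_ [mu [Cmu Zmu] <-]].
  by have [Zx xE] := measure_of_patternP Kx; exists (measure_of_pattern x).
have Kmu : K (pattern_mass mu) by exists mu.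
have [Zx xE] := measure_of_patternP Kmu; split => //.
exact: (limit_set_indistinguishable Zmu Zx (esym xE) clC Cmu).
Qed.

Definition limit_measure (w : T') : borel W := measure_of_pattern (Y w).

Lemma limit_measure_measurable : measurable_fun [set: T'] limit_measure.
Proof.
have mK : measurable (Y @^-1` K).
  exact: preimage_clamped_measurable (@limit_pattern_closed R).
have mC (C : set W) : closed C -> measurable (limit_measure @^-1` C).
  move=> clC; have mCK : measurable (Y @^-1` (K `&` measure_of_pattern @^-1` C)).
    rewrite preimage_measure_of_pattern//; apply: compact_ptws_measurable.
      exact: clamped_measurable.
    exact: pattern_mass_compact.
  have measure_of_patternN w : ~ K (Y w) -> limit_measure w = point.
    by move=> nK; apply: xgetPN => mu [Zmu muE]; apply: nK; exists mu.
  (* The lift is constantly [point] outside [K], so that part of the preimage is everything or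
     nothing. *)
  have [Cp|nCp] := pselect (C point).
    rewrite (_ : _ @^-1` _ = Y @^-1` (K `&` measure_of_pattern @^-1` C) `|` ~` (Y @^-1` K)).
      by apply: measurableU => //; exact: measurableC.
    apply/seteqP; split=> w /=.
      by have [Kw|nKw] := pselect (K (Y w)); [left|right].
    by case=> [[]//|nKw]; rewrite measure_of_patternN.
  rewrite (_ : _ @^-1` _ = Y @^-1` (K `&` measure_of_pattern @^-1` C))//.
  apply/seteqP; split=> w /=; last by case.
  move=> Cw; split => //; apply: contrapT => nKw; apply: nCp.
  by rewrite -(measure_of_patternN _ nKw).
apply: (@measurability _ _ _ (borel W) _ _ (@open W)) => [//|_ [A oA <-]].
rewrite setTI -[A]setCK preimage_setC; apply: measurableC.
exact: (mC (~` A) (open_closedC oA)).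
Qed.

HB.instance Definition _ :=
  isMeasurableFun.Build _ _ _ _ limit_measure limit_measure_measurable.

Lemma pattern_cvg_quenched : quenched_BS_cvg sigma.
Proof.
exists d', T', Q, limit_measure => g cg bg.
have /bounded_fun_leP[B gB] := bg.
have clK := @limit_pattern_closed R.
have cgl : {within K, continuous (g \o measure_of_pattern)}.
  apply/continuous_closedP => A clA; apply/closed_subspaceP.
  have clgA : closed (g @^-1` A) by move/continuous_closedP : cg; apply.
  exists ((@pattern_mass R) @` (g @^-1` A `&` @limit_set R)).
    by apply: compact_closed; [exact: ptws_hausdorff|exact: pattern_mass_compact].
  by rewrite -preimage_measure_of_pattern// setIC setIA setIid setIC.
(* Tietze's extension theorem needs a positive bound, hence the added 1. *)
have B0 : 0 < `|B| + 1 by rewrite ltr_wpDl.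
have gB' x : K x -> `|(g \o measure_of_pattern) x| <= `|B| + 1.
  by move=> _; rewrite (le_trans (gB _))// (le_trans (ler_norm B))// lerDl.
have [G [gG cG GB]] := continuous_bounded_extension
  (@pseudometric_normal R X) clK B0 cgl gB'.
have bG : bounded_fun G by apply/bounded_fun_leP; exists (`|B| + 1).
have gZ mu : limit_set mu -> g mu = G (pattern_mass mu).
  move=> Zmu; have Kmu : K (pattern_mass mu) by exists mu.
  rewrite -gG ?inE//=; have [Zx xE] := measure_of_patternP Kmu.
  have clE : closed (g @^-1` [set g mu]).
    by move/continuous_closedP : cg; apply; exact: closed_eq.
  exact: (esym (limit_set_indistinguishable Zmu Zx (esym xE) clE erefl)).
rewrite (_ : 'E_Q[_]%E = 'E_Q[G \o Y]%E); first exact: clamped_expectation_cvg.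
rewrite unlock; apply: ae_eq_integral => //.
- apply/measurable_EFinP; apply: (measurableT_comp _ limit_measure_measurable).
  exact: (continuous_borel_measurable cg).
- by apply/measurable_EFinP; exact: comp_clamped_measurable.
apply: negligibleS clamped_limit_pattern => w /=.
move=> nE Kw; apply: nE => _; congr (_%:E).
by rewrite -gG ?inE.
Qed.

End QuenchedLimit.

(* sigma n is a random permutation of size n + 1. *)
Theorem theorem1p5 (R : realType) (d : nat -> measure_display)
    (T : forall n : nat, measurableType (d n))
    (P : forall n : nat, probability (T n) R)
    (sigma : forall n : nat, {RV (P n) >-> 'S_n.+1}) :
  (annealed_BS_cvg sigma <->
     exists Delta : pattern -> R, (forall p : pattern, 0 <= Delta p) /\
       forall p : pattern,
         ('E_(P n)[fun w => prop_c_occ R p (sigma n w)] @[n --> \oo]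
            --> (Delta p)%:E)%E) /\
  (quenched_BS_cvg sigma <->
     exists (d' : measure_display) (T' : measurableType d')
         (Q : probability T' R) (Lambda : pattern -> {RV Q >-> R}),
       (forall (p : pattern) (w : T'), 0 <= Lambda p w) /\
       cvg_in_distribution (S := {ptws pattern -> R}) P
         (fun (n : nat) (w : T n) (p : pattern) => prop_c_occ R p (sigma n w))
         Q (fun (w : T') (p : pattern) => Lambda p w)) /\
  (quenched_BS_cvg sigma -> annealed_BS_cvg sigma).
Proof.
split; last split; last exact: quenched_annealed.
- split=> [|[Delta [_ cvgD]]]; first exact: annealed_cvg_pattern.
  exact: pattern_cvg_annealed cvgD.
- split=> [|[d' [T' [Q [Lambda [_ cvgL]]]]]]; first exact: quenched_cvg_pattern.
  exact: pattern_cvg_quenched cvgL.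
Qed.
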